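(* Let $T>0$ and suppose Isaacs' condition holds for all $t\in[t_0,t_0+T]$. Suppose there exists a piecewise-$C^1$ solution $P:[t_0,t_0+T]\to\mathbb H^n_{\succeq0}$ with $P(t_0+T)=Z_T$ of the impulsive Hamilton–Jacobi–Isaacs generalized Riccati equation (I-HJI-GRE). Then: (a) The saddle-point value is $J_T^\circ(X_1^0)=\langle P(t_0),X_1^0\rangle$. (b) The saddle-point is attained at gains $(K_u^s,K_w^s)$ from the saddle-point sets $\mathcal K_u^s\times\mathcal K_w^s$ (flow set on flow, jump set at each jump). (c) The saddle-point value equals the minimax and the maximin: $$J_T^\circ(X_1^0)=\min_{X_u}\max_{X_w}J_T=\max_{X_w}\min_{X_u}J_T=\langle P(t_0),X_1^0\rangle,$$ where $X_u=(X_{12},X_{22})$ are the minimizer's blocks and $X_w=(X_{13},X_{23},X_{33})$ the maximizer's blocks. (d) The solution $P$ is unique.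
   Context: Notation. Fix integers $n,m_u,m_w\ge1$, $m=m_u+m_w$. $\mathbb H^p$, $\mathbb H^p_{\succeq0}$: $p\times p$ complex Hermitian, resp. positive semidefinite, matrices; $\langle A,B\rangle=\operatorname{trace}(AB^* )$; $A^\dagger$ is the Moore–Penrose pseudoinverse. $E=[I_n\ \ 0]\in\mathbb C^{n\times(n+m)}$. Partition $X\in\mathbb H^{n+m}$ with block sizes $n,m_u,m_w$ as $X=\begin{bmatrix}X_1&X_{12}^*&X_{13}^*\\ X_{12}&X_{22}&X_{23}^*\\ X_{13}&X_{23}&X_{33}\end{bmatrix}$, $X_1=EXE^*$. System. Jump times $t_1<t_2<\cdots$, $t_k\to\infty$, those in $(t_0,t_0+T)$ being $t_1,\dots,t_{N_T}$; dynamics $$E\dot X(t)E^*=\mathcal F(t,X(t))\ (t\ne t_k),\quad EX(t_k^+)E^*=\mathcal J(k,X(t_k^-)),\quad EX(t_0)E^*=X_1^0\in\mathbb H^n_{\succeq0}.$$ $\mathcal F(t,\cdot),\mathcal J(k,\cdot):\mathbb H^{n+m}\to\mathbb H^n$ are linear and bounded, $\mathcal F$ is continuous in $t$, both leave the positive semidefinite cone invariant (the state block stays positive semidefinite); adjoints: $\langle P,\mathcal F(t,X)\rangle=\langle\mathcal F^*(t,P),X\rangle$, $\langle P,\mathcal J(k,X)\rangle=\langle\mathcal J^*(k,P),X\rangle$. A trajectory is an $\mathbb H^{n+m}_{\succeq0}$-valued function satisfying these equations (regular enough that the limits and integrals involved make sense). Game. $Z=\begin{bmatrix}Q&S_u&S_w\\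 S_u^*&R_u&R_{uw}\\ S_w^*&R_{uw}^*&-R_w\end{bmatrix}$ with $Q\succeq0$, $R_u\succ0$, $R_w\succ0$ and $\begin{bmatrix}Q&S_u\\ S_u^*&R_u\end{bmatrix}\succeq0$; the jump weights $Z_k\in\mathbb H^{n+m}$ carry the same block structure; $Z_T\in\mathbb H^n_{\succeq0}$. Cost $$J_T(X,X_1^0)=\int_{t_0}^{t_0+T}\langle Z(t),X(t)\rangle dt+\sum_{k=1}^{N_T}\langle Z_k,X(t_k^-)\rangle+\langle Z_T,EX(t_0+T)E^*\rangle.$$ The minimizer controls $(X_{12},X_{22})$, the maximizer controls $(X_{13},X_{23},X_{33})$, subject to $X(t)\succeq0$ and the dynamics; $J_T^\circ(X_1^0)=\min_{X_{12},X_{22}}\max_{X_{13},X_{23},X_{33}}J_T(X,X_1^0)$. HJI operators. $\mathcal I(t,P(t))=E^*\dot P(t)E+\mathcal F^*(t,P(t))+Z(t)$, $\mathcal I^{\mathrm j}(k,P(t_k^+),P(t_k^-))=\mathcal J^*(k,P(t_k^+))-E^*P(t_k^-)E+Z_k$. Any $\mathcal I\in\mathbb H^{n+m}$ is blocked as $\begin{bmatrix}\mathcal I_{11}&\mathcal I_{1u}&\mathcal I_{1w}\\ \mathcal I_{1u}^*&\mathcal I_{uu}&\mathcal I_{uw}\\ \mathcal I_{1w}^*&\mathcal I_{uw}^*&\mathcal I_{ww}\end{bmatrix}$, with Isaacs block $\mathcal G=\begin{bmatrix}\mathcal I_{uu}&\mathcal I_{uw}\\ \mathcal I_{uw}^*&\mathcal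 I_{ww}\end{bmatrix}$ and $\mathcal I_{1g}=[\mathcal I_{1u}\ \mathcal I_{1w}]$; $\mathcal G^{\mathrm j},\mathcal I^{\mathrm j}_{1g}$ are the corresponding blocks of $\mathcal I^{\mathrm j}$. Isaacs' condition for $\mathcal I$: $\mathcal I_{uu}\succeq0$, $\mathcal I_{ww}\preceq0$, $\mathcal I_{ww}-\mathcal I_{uw}^*\mathcal I_{uu}^\dagger\mathcal I_{uw}\preceq0$, $\mathcal I_{uu}-\mathcal I_{uw}\mathcal I_{ww}^\dagger\mathcal I_{uw}^*\succeq0$, $\operatorname{Im}\mathcal I_{uw}\subseteq\operatorname{Im}\mathcal I_{uu}$, $\operatorname{Im}\mathcal I_{uw}^*\subseteq\operatorname{Im}\mathcal I_{ww}$. I-HJI-GRE. A piecewise-$C^1$ $P$ (continuous and piecewise $C^1$ between jumps, one-sided limits at jumps) with $P(t_0+T)=Z_T$ such that, for $\mathcal I=\mathcal I(t,P(t))$ (a.e. $t$) and likewise for $\mathcal I=\mathcal I^{\mathrm j}(k,P(t_k^+),P(t_k^-))$ ($k=1,\dots,N_T$): $\mathcal I_{11}-\mathcal I_{1g}\mathcal G^\dagger\mathcal I_{1g}^*=0$, $\mathcal G\mathcal G^\dagger\mathcal I_{1g}^*=\mathcal I_{1g}^*$, and Isaacs' condition holds. Saddle-point sets. $(K_u,K_w)\in\mathbb C^{m_u\times n}\times\mathbb C^{m_w\times n}$ with $\mathcal G\begin{bmatrix}K_u\\ K_w\end{bmatrix}+\mathcal I_{1g}^*=0$ (flow), and the same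 with $\mathcal G^{\mathrm j},\mathcal I_{1g}^{\mathrm j}$ (jump). Playing these gains means $X=\begin{bmatrix}I\\ K_u\\ K_w\end{bmatrix}X_1\begin{bmatrix}I\\ K_u\\ K_w\end{bmatrix}^*$.
   Formalization: Added: the saddle-point sets of P (and in (d) of any competing solution) must contain piecewise-continuous gains; otherwise the saddle closed loop can blow up and P need not be unique. The outer player in min/max uses feedback laws; trajectories are piecewise continuous. *)

(* Defs.v *)
From HB Require Import structures.
From mathcomp Require Import all_boot all_order all_algebra.
From mathcomp Require Import spectral complex.
From mathcomp Require Import all_classical all_reals all_analysis.
Set Implicit Arguments.
Unset Strict Implicit.
Unset Printing Implicit Defensive.
Import Order.TTheory GRing.Theory Num.Theory.
Import numFieldNormedType.Exports.
Local Open Scope classical_set_scope.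
Local Open Scope sesquilinear_scope.
Local Open Scope ring_scope.

Section matrices.
Variable R : realType.
Local Notation C := R[i].

Definition psd p (A : 'M[C]_p) : Prop :=
  A \is hermsymmx /\ forall v : 'cV[C]_p, 0 <= (v ^t* *m A *m v) 0 0.

Definition pd p (A : 'M[C]_p) : Prop :=
  A \is hermsymmx /\ forall v : 'cV[C]_p, v != 0 -> 0 < (v ^t* *m A *m v) 0 0.

(* trace (A B^* ) is real when A and B are Hermitian, the only case in use;
   taking the real part only fixes the codomain. *)
Definition ip p (A B : 'M[C]_p) : R := complex.Re (\tr (A *m B ^t*)).

Definition penrose p q (A : 'M[C]_(p, q)) (B : 'M[C]_(q, p)) : Prop :=
  [/\ A *m B *m A = A, B *m A *m B = B,
      (A *m B) ^t* = A *m B & (B *m A) ^t* = B *m A].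

(* Moore-Penrose pseudoinverse; MathComp's pinvmx is a different one. *)
Definition mppinv p q (A : 'M[C]_(p, q)) : 'M[C]_(q, p) :=
  xget 0 [set B | penrose A B].

(* MathComp's row-space order, so the column spaces are compared
   through the transposes. *)
Definition im_sub p q r (A : 'M[C]_(p, q)) (B : 'M[C]_(p, r)) : Prop :=
  (A^T <= B^T)%MS.

End matrices.

(* Analysis of matrix-valued functions of a real variable, carried out on the
   real and imaginary parts of the entries. *)
Section matrix_functions.
Variable R : realType.
Local Notation C := R[i].

Definition parts p q (Q : (R -> R) -> Prop) (A : R -> 'M[C]_(p, q)) : Prop :=
  forall i j, Q (fun t => complex.Re (A t i j)) /\
              Q (fun t => complex.Im (A t i j)).

Definition mlim p q (A : R -> 'M[C]_(p, q)) (D : set_system R) : 'M[C]_(p, q) :=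
  \matrix_(i, j) Complex (lim (complex.Re (A t i j) @[t --> D]))
                         (lim (complex.Im (A t i j) @[t --> D])).

Definition mcvg p q (A : R -> 'M[C]_(p, q)) (D : set_system R)
    (L : 'M[C]_(p, q)) : Prop :=
  forall i j, complex.Re (A t i j) @[t --> D] --> complex.Re (L i j) /\
              complex.Im (A t i j) @[t --> D] --> complex.Im (L i j).

Definition mderive p q (A : R -> 'M[C]_(p, q)) (t : R) : 'M[C]_(p, q) :=
  \matrix_(i, j) Complex (derive1 (fun s => complex.Re (A s i j)) t)
                         (derive1 (fun s => complex.Im (A s i j)) t).

Definition mderivable p q (A : R -> 'M[C]_(p, q)) (t : R) : Prop :=
  parts (fun f => derivable f t 1) A.

(* f restricted to [a, b]: one-sided limits everywhere, continuity inside
   except at finitely many points; the values at those points and at a, b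
   are unconstrained. *)
Definition pw_continuous (a b : R) (f : R -> R) : Prop :=
  exists D : seq R,
    [/\ forall t, a < t < b -> t \notin D -> {for t, continuous f},
        forall t, a <= t < b -> cvg (f x @[x --> t^'+])
      & forall t, a < t <= b -> cvg (f x @[x --> t^'-])].

Definition pw_C1 (a b : R) (f : R -> R) : Prop :=
  [/\ pw_continuous a b f,
      exists D : seq R, forall t, a < t < b -> t \notin D -> derivable f t 1
    & pw_continuous a b (derive1 f)].

(* Two-sided continuity on [a, b] off the set S, one-sided at a and at b. *)
Definition mcontinuous_off p q (a b : R) (S : set R)
    (A : R -> 'M[C]_(p, q)) : Prop :=
  (forall t, a <= t < b -> ~ S t -> mcvg A t^'+ (A t)) /\
  (forall t, a < t <= b -> ~ S t -> mcvg A t^'- (A t)).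

End matrix_functions.

(* Block access; X is partitioned with sizes n, m_u, m_w. *)
Section blocks.
Variables (R : realType) (n mu mw : nat).
Local Notation C := R[i].
Local Notation mat := 'M[C]_(n + (mu + mw)).

Definition Emx : 'M[C]_(n, n + (mu + mw)) := row_mx 1%:M 0.
Definition state (X : mat) : 'M[C]_n := Emx *m X *m Emx ^t*.

Definition X12 (X : mat) : 'M[C]_(mu, n) := usubmx (dlsubmx X).
Definition X13 (X : mat) : 'M[C]_(mw, n) := dsubmx (dlsubmx X).
Definition X22 (X : mat) : 'M[C]_mu := ulsubmx (drsubmx X).
Definition X23 (X : mat) : 'M[C]_(mw, mu) := dlsubmx (drsubmx X).
Definition X33 (X : mat) : 'M[C]_mw := drsubmx (drsubmx X).

Definition blk11 (I : mat) : 'M[C]_n := ulsubmx I.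
Definition blk1g (I : mat) : 'M[C]_(n, mu + mw) := ursubmx I.
Definition isaacs_block (I : mat) : 'M[C]_(mu + mw) := drsubmx I.
Definition blkuu (I : mat) : 'M[C]_mu := ulsubmx (isaacs_block I).
Definition blkuw (I : mat) : 'M[C]_(mu, mw) := ursubmx (isaacs_block I).
Definition blkww (I : mat) : 'M[C]_mw := drsubmx (isaacs_block I).

Definition isaacs (I : mat) : Prop :=
  let Iuu := blkuu I in let Iuw := blkuw I in let Iww := blkww I in
  [/\ psd Iuu /\ psd (- Iww),
      psd (- (Iww - Iuw ^t* *m mppinv Iuu *m Iuw)),
      psd (Iuu - Iuw *m mppinv Iww *m Iuw ^t*),
      im_sub Iuw Iuu
    & im_sub (Iuw ^t*) Iww].

Definition riccati (I : mat) : Prop :=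
  let G := isaacs_block I in let I1g := blk1g I in
  [/\ blk11 I - I1g *m mppinv G *m I1g ^t* = 0,
      G *m mppinv G *m I1g ^t* = I1g ^t*
    & isaacs I].

Definition saddle_set (I : mat) (Ku : 'M[C]_(mu, n)) (Kw : 'M[C]_(mw, n)) :=
  isaacs_block I *m col_mx Ku Kw + (blk1g I) ^t* = 0.

(* [Q S_u S_w; S_u^* R_u R_uw; S_w^* R_uw^* -R_w] with its sign conditions. *)
Definition game_weight (Z : mat) : Prop :=
  let Q := blk11 Z in let Su := lsubmx (blk1g Z) in
  [/\ Z \is hermsymmx, psd Q, pd (blkuu Z), pd (- blkww Z)
    & psd (block_mx Q Su (Su ^t*) (blkuu Z))].

Definition lift_gains (Ku : 'M[C]_(mu, n)) (Kw : 'M[C]_(mw, n))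
    (X1 : 'M[C]_n) : mat :=
  let L := col_mx 1%:M (col_mx Ku Kw) in L *m X1 *m L ^t*.

End blocks.

(* The jump times t_1 < t_2 < ... are tj 0 < tj 1 < ...; all the jump data
   are shifted accordingly. *)
Record game (R : realType) (n mu mw : nat) := Game {
  t0 : R;
  horizon : R;
  tj : nat -> R;
  njumps : nat;
  flow : R -> 'M[R[i]]_(n + (mu + mw)) -> 'M[R[i]]_n;
  flow_adj : R -> 'M[R[i]]_n -> 'M[R[i]]_(n + (mu + mw));
  jump : nat -> 'M[R[i]]_(n + (mu + mw)) -> 'M[R[i]]_n;
  jump_adj : nat -> 'M[R[i]]_n -> 'M[R[i]]_(n + (mu + mw));
  Zflow : R -> 'M[R[i]]_(n + (mu + mw));
  Zjump : nat -> 'M[R[i]]_(n + (mu + mw));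
  Zend : 'M[R[i]]_n
}.

Section games.
Variables (R : realType) (n mu mw : nat) (g : game R n mu mw).
Local Notation C := R[i].
Local Notation mat := 'M[C]_(n + (mu + mw)).
Local Notation a := (t0 g).
Local Notation b := (t0 g + horizon g).
Local Notation mes := (@lebesgue_measure R).

Definition jump_time (t : R) : Prop :=
  exists2 k, (k < njumps g)%N & t = tj g k.

(* Real-linear map between spaces of Hermitian matrices; boundedness is
   automatic in finite dimension. *)
Definition hermitian_linear p q (f : 'M[C]_p -> 'M[C]_q) : Prop :=
  (forall X, X \is hermsymmx -> f X \is hermsymmx) /\
  (forall (c : R) X Y, X \is hermsymmx -> Y \is hermsymmx ->
     f (Complex c 0 *: X + Y) = Complex c 0 *: f X + f Y).

Definition adjoint_of p q (f : 'M[C]_q -> 'M[C]_p) (fs : 'M[C]_p -> 'M[C]_q) :=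
  (forall P, P \is hermsymmx -> fs P \is hermsymmx) /\
  (forall P X, P \is hermsymmx -> X \is hermsymmx -> ip P (f X) = ip (fs P) X).

(* The flow keeps the state block in the cone.  Every X >= 0 with state block
   Y reads L Y L^* + diag(0, S) with L = [I; K] and S >= 0; K and S are the
   inputs of the differential equation, whose solution Y is not assumed to be
   psd after the initial time. *)
Definition flow_invariant : Prop :=
  forall (s e : R) (K : R -> 'M[C]_(mu + mw, n)) (S : R -> 'M[C]_(mu + mw))
      (Y : R -> 'M[C]_n),
    a <= s -> s < e -> e <= b ->
    parts (pw_continuous s e) K -> parts (pw_continuous s e) S ->
    (forall t, psd (S t)) ->
    (forall t, Y t \is hermsymmx) ->
    mcontinuous_off s e set0 Y ->
    (exists D : seq R, forall t, s < t < e -> t \notin D ->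
       mderivable Y t /\
       mderive Y t = flow g t (col_mx 1%:M (K t) *m Y t *m (col_mx 1%:M (K t)) ^t*
                               + block_mx 0 0 0 (S t))) ->
    psd (Y s) -> forall t, s <= t <= e -> psd (Y t).

Record standing : Prop := {
  horizon_gt0 : 0 < horizon g;
  tj_increasing : forall k l, (k < l)%N -> tj g k < tj g l;
  tj_unbounded : tj g k @[k --> \oo] --> +oo;
  tj_window : forall k, (a < tj g k < b) = (k < njumps g)%N;
  flow_linear : forall t, hermitian_linear (flow g t);
  flow_continuous : forall X, X \is hermsymmx ->
    parts (fun f => {within `[a, b], continuous f}) (fun t => flow g t X);
  flow_adjoint : forall t, adjoint_of (flow g t) (flow_adj g t);
  flow_cone : flow_invariant;
  jump_linear : forall k, hermitian_linear (jump g k);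
  jump_adjoint : forall k, adjoint_of (jump g k) (jump_adj g k);
  jump_cone : forall k X, psd X -> psd (jump g k X);
  Zflow_weight : forall t, a <= t <= b -> game_weight (Zflow g t);
  Zflow_integrable :
    parts (fun f => mes.-integrable `[a, b] (EFin \o f)) (Zflow g);
  Zjump_weight : forall k, game_weight (Zjump g k);
  Zend_psd : psd (Zend g)
}.

(* X (tj k) stands for X(t_k^-): its state block is the left limit of the state
   block, while its control blocks are the ones chosen at the jump, not the
   left limits of the controls played on the flow. *)
Definition trajectory (X10 : 'M[C]_n) (X : R -> mat) : Prop :=
  let X1 t := state (X t) in
  [/\ (forall t, a <= t <= b -> psd (X t)) /\ parts (pw_continuous a b) X,
      mcontinuous_off a b jump_time X1 /\
        (forall k, (k < njumps g)%N -> mcvg X1 (tj g k)^'- (X1 (tj g k))),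
      exists D : seq R, forall t, a < t < b -> t \notin D ->
        mderivable X1 t /\ mderive X1 t = flow g t (X t),
      forall k, (k < njumps g)%N -> mcvg X1 (tj g k)^'+ (jump g k (X (tj g k)))
    & X1 a = X10].

Definition cost (X : R -> mat) : R :=
  Rintegral mes `[a, b] (fun t => ip (Zflow g t) (X t))
  + \sum_(k < njumps g) ip (Zjump g k) (X (tj g k))
  + ip (Zend g) (state (X b)).

Definition hji (P : R -> 'M[C]_n) (t : R) : mat :=
  (Emx R n mu mw) ^t* *m mderive P t *m Emx R n mu mw
  + flow_adj g t (P t) + Zflow g t.

Definition hji_jump (P : R -> 'M[C]_n) (k : nat) : mat :=
  jump_adj g k (mlim P (tj g k)^'+)
  - (Emx R n mu mw) ^t* *m mlim P (tj g k)^'- *m Emx R n mu mw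
  + Zjump g k.

(* The value of P at a jump time is immaterial; only P(t_k^-), P(t_k^+) enter. *)
Definition gre_solution (P : R -> 'M[C]_n) : Prop :=
  [/\ (forall t, a <= t <= b -> psd (P t)) /\ P b = Zend g,
      parts (pw_C1 a b) P /\ mcontinuous_off a b jump_time P,
      {ae mes, forall t, a <= t <= b -> riccati (hji P t)}
    & forall k, (k < njumps g)%N -> riccati (hji_jump P k)].

Definition isaacs_everywhere (P : R -> 'M[C]_n) : Prop :=
  (forall t, a <= t <= b -> ~ jump_time t -> isaacs (hji P t)) /\
  (forall k, (k < njumps g)%N -> isaacs (hji_jump P k)).

(* Gains at t = tj k are the ones played at the k-th jump. *)
Definition gains p (K : R -> 'M[C]_(p, n)) : Prop := parts (pw_continuous a b) K.

Definition saddle_gains (P : R -> 'M[C]_n)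
    (Ku : R -> 'M[C]_(mu, n)) (Kw : R -> 'M[C]_(mw, n)) : Prop :=
  [/\ gains Ku, gains Kw,
      {ae mes, forall t, a <= t <= b -> saddle_set (hji P t) (Ku t) (Kw t)}
    & forall k, (k < njumps g)%N ->
        saddle_set (hji_jump P k) (Ku (tj g k)) (Kw (tj g k))].

(* Strategies are feedback laws.  The minimizer maps (t, X1) to (X12, X22).
   The maximizer maps (t, X1) to (X13, X33); the cross block X23 correlates
   the two players' inputs, so its law may also depend on (X12, X22): a law
   for X23 blind to them could not keep X psd against all of them. *)
Definition min_law := R -> 'M[C]_n -> 'M[C]_(mu, n) * 'M[C]_mu.

Record max_law := MaxLaw {
  own_blocks : R -> 'M[C]_n -> 'M[C]_(mw, n) * 'M[C]_mw;
  cross_block : R -> 'M[C]_n -> 'M[C]_(mu, n) * 'M[C]_mu -> 'M[C]_(mw, mu)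
}.

Definition state_min_block (X1 : 'M[C]_n) (U : 'M[C]_(mu, n) * 'M[C]_mu) :
  'M[C]_(n + mu) := block_mx X1 (U.1 ^t*) U.1 U.2.

Definition assemble (X1 : 'M[C]_n) (U : 'M[C]_(mu, n) * 'M[C]_mu)
    (W : 'M[C]_(mw, n) * 'M[C]_mw) (c : 'M[C]_(mw, mu)) : mat :=
  block_mx X1 (row_mx (U.1 ^t*) (W.1 ^t*))
           (col_mx U.1 W.1) (block_mx U.2 (c ^t*) c W.2).

Definition follows_min (f : min_law) (X : R -> mat) : Prop :=
  forall t, a <= t <= b -> (X12 (X t), X22 (X t)) = f t (state (X t)).

Definition follows_max (h : max_law) (X : R -> mat) : Prop :=
  forall t, a <= t <= b ->
    (X13 (X t), X33 (X t)) = own_blocks h t (state (X t)) /\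
    X23 (X t) = cross_block h t (state (X t)) (X12 (X t), X22 (X t)).

(* u = K_u x and w = K_w x. *)
Definition gain_min (Ku : R -> 'M[C]_(mu, n)) : min_law :=
  fun t X1 => (Ku t *m X1, Ku t *m X1 *m (Ku t) ^t*).

Definition gain_max (Kw : R -> 'M[C]_(mw, n)) : max_law :=
  MaxLaw (fun t X1 => (Kw t *m X1, Kw t *m X1 *m (Kw t) ^t*))
         (fun t _ U => Kw t *m U.1 ^t*).

(* A law is admissible if its blocks are compatible with X >= 0 whatever the
   other player does, and if the closed loop with any linear feedback of the
   other player has a solution. *)
Definition admissible_min (X10 : 'M[C]_n) (f : min_law) : Prop :=
  (forall t X1, a <= t <= b -> psd X1 -> psd (state_min_block X1 (f t X1))) /\
  (forall Kw, gains Kw -> exists X,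
     [/\ trajectory X10 X, follows_min f X & follows_max (gain_max Kw) X]).

Definition admissible_max (X10 : 'M[C]_n) (h : max_law) : Prop :=
  (forall t X1 U, a <= t <= b -> psd (state_min_block X1 U) ->
     psd (assemble X1 U (own_blocks h t X1) (cross_block h t X1 U))) /\
  (forall Ku, gains Ku -> exists X,
     [/\ trajectory X10 X, follows_max h X & follows_min (gain_min Ku) X]).

(* Costs the other player can still produce, through any controls whatsoever,
   once a law is fixed. *)
Definition costs_min (X10 : 'M[C]_n) (f : min_law) : set R :=
  [set cost X | X in [set X | trajectory X10 X /\ follows_min f X]].

Definition costs_max (X10 : 'M[C]_n) (h : max_law) : set R :=
  [set cost X | X in [set X | trajectory X10 X /\ follows_max h X]].

Definition is_max (A : set R) (v : R) : Prop := A v /\ ubound A v.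
Definition is_min (A : set R) (v : R) : Prop := A v /\ lbound A v.

(* Both optima are attained; for the laws whose inner optimum is not attained
   the supremum (infimum) in the extended reals is compared. *)
Definition minimax_value (X10 : 'M[C]_n) (v : R) : Prop :=
  (exists2 f, admissible_min X10 f & is_max (costs_min X10 f) v) /\
  (forall f, admissible_min X10 f ->
     (v%:E <= ereal_sup (EFin @` costs_min X10 f))%E).

Definition maximin_value (X10 : 'M[C]_n) (v : R) : Prop :=
  (exists2 h, admissible_max X10 h & is_min (costs_max X10 h) v) /\
  (forall h, admissible_max X10 h ->
     (ereal_inf (EFin @` costs_max X10 h) <= v%:E)%E).

Definition saddle_point (X10 : 'M[C]_n)
    (Ku : R -> 'M[C]_(mu, n)) (Kw : R -> 'M[C]_(mw, n)) (v : R) : Prop :=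
  [/\ admissible_min X10 (gain_min Ku) /\ admissible_max X10 (gain_max Kw),
      exists X, [/\ trajectory X10 X,
        forall t, a <= t <= b -> X t = lift_gains (Ku t) (Kw t) (state (X t))
        & cost X = v],
      forall X, trajectory X10 X -> follows_min (gain_min Ku) X -> cost X <= v
    & forall X, trajectory X10 X -> follows_max (gain_max Kw) X -> v <= cost X].

End games.

(* Main.v *)
Require Import Defs.
From HB Require Import structures.
From mathcomp Require Import all_boot all_order all_algebra.
From mathcomp Require Import spectral complex.
From mathcomp Require Import all_classical all_reals all_analysis.
From mathcomp Require Import measurable_realfun.
From mathcomp Require Import ring lra.
Set Implicit Arguments.
Unset Strict Implicit.
Unset Printing Implicit Defensive.
Import Order.TTheory GRing.Theory Num.Theory.
Import numFieldNormedType.Exports.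
Local Open Scope classical_set_scope.
Local Open Scope sesquilinear_scope.
Local Open Scope ring_scope.

(** A verification argument.  Along a trajectory [X], differentiate the pairing
    of [P] with the state block [X1] and add its jumps.  The adjoints turn the
    dynamics into the operators of the Isaacs equation, and the cost becomes the
    initial pairing [ip (P a) X10], plus the integral of [ip (hji t) (X t)],
    plus the sum of the [ip (hji_jump k) (X (tj k))] ([cost_expansion]).

    Let [I] be one of these operators, [K = col_mx Ku Kw] a saddle gain, [G] the
    Isaacs block of [I], and [T = (- K  1)], with adjoint [T'].  The Riccati
    equation says that [I = T' G T] ([completion_of_squares]), so that
    [ip I X = ip G (T X T')].  If the minimizer plays [Ku], then [T X T'] is
    carried by the block of the maximizer, where [G] is negative semidefinite,
    and the pairing is at most 0; if the maximizer plays [Kw] it is at least 0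
    ([ip_min_feedback], [ip_max_feedback]).  Hence each player secures the value
    with a saddle gain, whatever the other one does.

    This is an optimum only if the laws can be played against each other: for
    any two piecewise continuous gains the closed loop must have a trajectory in
    the cone ([feedback_trajectory]).  In real coordinates on the Hermitian
    matrices it is a linear differential equation with piecewise continuous
    coefficients.  It is solved by Picard iteration between two consecutive
    exceptional instants ([linear_ode_solution]), the solution stays in the cone
    by the invariance of the flow, and the pieces are concatenated through the
    jumps ([arc_glue]).  Applied to an arbitrary admissible law and a saddle gain
    of the opponent, the same bounds give the optimality of the value among all
    laws ([gre_minimax_value], [gre_maximin_value]).

    For uniqueness, the game restarted at an instant [s] that is not a jump is a
    game of the same kind ([from_time]) and the restriction of any solution
    solves its Riccati equation.  Its minimax value is therefore
    [ip (P s) X10] for every solution [P] and every [X10] in the cone, which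
    determines [P s]; the limits at the jumps follow. *)

(** * Adjoints, the trace form and the positive semidefinite cone *)

Section adjoint.
Variable R : realType.
Local Notation C := R[i].

Lemma adjmxM p q r (A : 'M[C]_(p, q)) (B : 'M[C]_(q, r)) :
  (A *m B) ^t* = B ^t* *m A ^t*.
Proof. by rewrite trmx_mul map_mxM. Qed.

Lemma adjmxD p q (A B : 'M[C]_(p, q)) : (A + B) ^t* = A ^t* + B ^t*.
Proof. by rewrite linearD /= map_mxD. Qed.

Lemma adjmxN p q (A : 'M[C]_(p, q)) : (- A) ^t* = - A ^t*.
Proof. by rewrite linearN /= map_mxN. Qed.

Lemma adjmx0 p q : (0 : 'M[C]_(p, q)) ^t* = 0.
Proof. by rewrite trmx0 map_mx0. Qed.

Lemma adjmx1 p : (1%:M : 'M[C]_p) ^t* = 1%:M.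
Proof. by rewrite trmx1 map_mx1. Qed.

Lemma adj_row_mx p q r (A : 'M[C]_(p, q)) (B : 'M[C]_(p, r)) :
  (row_mx A B) ^t* = col_mx (A ^t*) (B ^t*).
Proof. by rewrite tr_row_mx map_col_mx. Qed.

Lemma adj_col_mx p q r (A : 'M[C]_(p, q)) (B : 'M[C]_(r, q)) :
  (col_mx A B) ^t* = row_mx (A ^t*) (B ^t*).
Proof. by rewrite tr_col_mx map_row_mx. Qed.

Lemma adjmxE p q (A : 'M[C]_(p, q)) i j : (A ^t*) i j = (A j i)^*.
Proof. by rewrite !mxE. Qed.

Lemma hermP p (A : 'M[C]_p) : A \is hermsymmx <-> A ^t* = A.
Proof.
rewrite is_hermitianmxE expr0 scale1r.
by split=> [/eqP h|h]; [rewrite -h|rewrite h].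
Qed.

Lemma hermD p (A B : 'M[C]_p) :
  A \is hermsymmx -> B \is hermsymmx -> A + B \is hermsymmx.
Proof. by move=> /hermP hA /hermP hB; apply/hermP; rewrite adjmxD hA hB. Qed.

Lemma hermN p (A : 'M[C]_p) : A \is hermsymmx -> - A \is hermsymmx.
Proof. by move=> /hermP hA; apply/hermP; rewrite adjmxN hA. Qed.

Lemma herm_congr p q (M : 'M[C]_(p, q)) (A : 'M[C]_q) :
  A \is hermsymmx -> M *m A *m M ^t* \is hermsymmx.
Proof.
by move=> /hermP hA; apply/hermP; rewrite !adjmxM trmxCK hA mulmxA.
Qed.

Lemma Re_conjC (z : C) : complex.Re (z^*) = complex.Re z.
Proof. by case: z. Qed.
Lemma Im_conjC (z : C) : complex.Im (z^*) = - complex.Im z.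
Proof. by case: z. Qed.
Lemma Re_add (z w : C) : complex.Re (z + w) = complex.Re z + complex.Re w.
Proof. by case: z; case: w. Qed.
Lemma Im_add (z w : C) : complex.Im (z + w) = complex.Im z + complex.Im w.
Proof. by case: z; case: w. Qed.
Lemma Re_opp (z : C) : complex.Re (- z) = - complex.Re z.
Proof. by case: z. Qed.
Lemma Re_mul (z w : C) : complex.Re (z * w) =
  complex.Re z * complex.Re w - complex.Im z * complex.Im w.
Proof. by case: z; case: w. Qed.
Lemma Im_mul (z w : C) : complex.Im (z * w) =
  complex.Re z * complex.Im w + complex.Im z * complex.Re w.
Proof. by case: z; case: w. Qed.
Lemma Re_sum I (r : seq I) (Q : pred I) (F : I -> C) :
  complex.Re (\sum_(i <- r | Q i) F i) = \sum_(i <- r | Q i) complex.Re (F i).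
Proof. by apply: (big_morph _ Re_add). Qed.
Lemma Im_sum I (r : seq I) (Q : pred I) (F : I -> C) :
  complex.Im (\sum_(i <- r | Q i) F i) = \sum_(i <- r | Q i) complex.Im (F i).
Proof. by apply: (big_morph _ Im_add). Qed.
Lemma complex_ext (z w : C) :
  complex.Re z = complex.Re w -> complex.Im z = complex.Im w -> z = w.
Proof. by case: z => a b; case: w => c d /= -> ->. Qed.

(** In the real coordinates of the entries the trace form is the Euclidean
    inner product: this is the form in which it is differentiated and
    integrated. *)
Lemma ipE p (A B : 'M[C]_p) :
  ip A B = \sum_i \sum_j (complex.Re (A i j) * complex.Re (B i j)
                          + complex.Im (A i j) * complex.Im (B i j)).
Proof.
rewrite /ip /mxtrace Re_sum; apply: eq_bigr => i _.
rewrite mxE Re_sum; apply: eq_bigr => j _.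
by rewrite adjmxE Re_mul Re_conjC Im_conjC mulrN opprK.
Qed.

Lemma ipDl p (A B X : 'M[C]_p) : ip (A + B) X = ip A X + ip B X.
Proof. by rewrite /ip mulmxDl linearD /= Re_add. Qed.

Lemma ipNl p (A X : 'M[C]_p) : ip (- A) X = - ip A X.
Proof. by rewrite /ip mulNmx linearN /= Re_opp. Qed.

Lemma ipBl p (A B X : 'M[C]_p) : ip (A - B) X = ip A X - ip B X.
Proof. by rewrite ipDl ipNl. Qed.

Lemma ip_congr p q (M : 'M[C]_(q, p)) (A : 'M[C]_q) (X : 'M[C]_p) :
  ip (M ^t* *m A *m M) X = ip A (M *m X *m M ^t*).
Proof.
by rewrite /ip !adjmxM trmxCK -!mulmxA mxtrace_mulC !mulmxA.
Qed.

Lemma ipxx_eq0 p (A : 'M[C]_p) : ip A A = 0 -> A = 0.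
Proof.
rewrite ipE => h; have ge0 i j : 0 <= complex.Re (A i j) * complex.Re (A i j)
    + complex.Im (A i j) * complex.Im (A i j).
  by rewrite addr_ge0// -expr2 sqr_ge0.
apply/matrixP => i j; rewrite mxE.
have /eqP : \sum_j (complex.Re (A i j) * complex.Re (A i j) + complex.Im (A i j) * complex.Im (A i j)) = 0.
  by apply: (psumr_eq0P _ h) => // k _; apply: sumr_ge0 => l _; exact: ge0.
rewrite psumr_eq0 => [|? _]; last exact: ge0.
move=> /allP /(_ j (mem_index_enum _)) /=.
rewrite paddr_eq0 -?expr2 ?sqr_ge0// !sqrf_eq0 => /andP[/eqP ? /eqP ?].
exact: complex_ext.
Qed.

Lemma ge0_complexE (z : C) : (0 <= z) = (complex.Im z == 0) && (0 <= complex.Re z).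
Proof. by rewrite lecE. Qed.

Lemma psd_gram p q (B : 'M[C]_(p, q)) : psd (B *m B ^t*).
Proof.
split; first by apply/hermP; rewrite adjmxM trmxCK.
move=> v.
have -> : v ^t* *m (B *m B ^t*) *m v = (B ^t* *m v) ^t* *m (B ^t* *m v).
  by rewrite adjmxM trmxCK !mulmxA.
by rewrite mxE; apply: sumr_ge0 => i _; rewrite adjmxE mulrC mul_conjC_ge0.
Qed.

(** The square root read off a unitary diagonalisation; it turns every
    statement on the cone into one on the rows of [B]. *)
Lemma psd_factor p (A : 'M[C]_p) : psd A -> exists B : 'M[C]_p, A = B *m B ^t*.
Proof.
move=> [hA pA]; have /orthomx_spectralP EA := hermitian_normalmx hA.
have uP := spectral_unitarymx A.
rewrite (invmx_unitary uP) in EA.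
move: (spectralmx A) (spectral_diag A) uP EA => U d uP EA.
have UU : U *m U ^t* = 1%:M by apply/unitarymxP.
have dge0 i : 0 <= d 0 i.
  have := pA (U ^t* *m delta_mx i 0).
  rewrite EA adjmxM trmxCK !mulmxA.
  rewrite -(mulmxA _ U (U ^t*)) UU mulmx1.
  rewrite -(mulmxA _ U (U ^t*)) UU mulmx1.
  have -> : (delta_mx i 0 : 'cV[C]_p)^t* = delta_mx 0 i.
    by apply/matrixP => a b; rewrite !mxE andbC; case: (_ && _); rewrite /= ?conjC1 ?conjC0.
  by rewrite -rowE -colE !mxE eqxx.
exists (U ^t* *m diag_mx (map_mx sqrtC d)).
set D := diag_mx _.
have -> : (U ^t* *m D) ^t* = D *m U.
  rewrite adjmxM trmxCK tr_diag_mx map_diag_mx; congr (diag_mx _ *m _).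
  by apply/matrixP => a b; rewrite !mxE; apply: geC0_conj; rewrite sqrtC_ge0 ord1.
have DD : D *m D = diag_mx d.
  rewrite /D mulmx_diag; apply: congr1; apply/matrixP => a b.
  by rewrite !mxE -expr2 sqrtCK ord1.
by rewrite mulmxA -(mulmxA _ D D) DD.
Qed.

Lemma psd_congr p q (M : 'M[C]_(p, q)) (A : 'M[C]_q) :
  psd A -> psd (M *m A *m M ^t*).
Proof.
move=> /psd_factor[B ->]; rewrite !mulmxA -mulmxA -adjmxM.
exact: psd_gram.
Qed.

Lemma ip_gram p q (A : 'M[C]_p) (B : 'M[C]_(p, q)) :
  ip A (B *m B ^t*) = complex.Re (\tr (B ^t* *m A *m B)).
Proof. by rewrite /ip adjmxM trmxCK mulmxA mxtrace_mulC mulmxA. Qed.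

(** The pairing is the sum of the quadratic form of [A] over the columns of
    [B]. *)
Lemma psd_ip_ge0 p q (A : 'M[C]_p) (B : 'M[C]_(p, q)) :
  psd A -> 0 <= ip A (B *m B ^t*).
Proof.
move=> [_ pA]; rewrite ip_gram /mxtrace Re_sum; apply: sumr_ge0 => i _.
have := pA (col i B); rewrite ge0_complexE => /andP[_].
have -> : (col i B)^t* = row i (B ^t*) by apply/matrixP => a b; rewrite !mxE.
have <- // : (B ^t* *m A *m B) i i = ((row i (B ^t*)) *m A *m col i B) 0 0.
by rewrite -!row_mul !mxE; apply: eq_bigr => k _; rewrite !mxE.
Qed.

Lemma gram_eq0 p q (B : 'M[C]_(p, q)) : B *m B ^t* = 0 -> B = 0.
Proof.
move=> h; apply/matrixP => i j; rewrite [RHS]mxE; apply/eqP.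
have /matrixP/(_ i i)/eqP := h; rewrite !mxE psumr_eq0; last first.
  by move=> k _; rewrite adjmxE mul_conjC_ge0.
move=> /allP/(_ j (mem_index_enum _)) /=.
by rewrite adjmxE mul_conjC_eq0.
Qed.

(** The difference annihilates the rank one matrices, so its quadratic form
    vanishes and it lies in the cone; then it annihilates itself. *)
Lemma herm_ip_psd_inj p (A B : 'M[C]_p) :
  A \is hermsymmx -> B \is hermsymmx ->
  (forall X, psd X -> ip A X = ip B X) -> A = B.
Proof.
move=> hA hB h; apply/eqP; rewrite -subr_eq0; apply/eqP; apply: ipxx_eq0.
have hD : A - B \is hermsymmx by exact: (hermD hA (hermN hB)).
have D0 X : psd X -> ip (A - B) X = 0 by move=> pX; rewrite ipBl h// subrr.
apply: (D0); split=> // v; rewrite ge0_complexE.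
have := D0 _ (psd_gram v); rewrite ip_gram /mxtrace big_ord1 => ->.
rewrite lexx andbT.
have : ((v ^t* *m (A - B) *m v)^t*) 0 0 = (v ^t* *m (A - B) *m v) 0 0.
  by rewrite !adjmxM trmxCK (proj1 (hermP _) hD) mulmxA.
rewrite adjmxE => /(congr1 (fun z => complex.Im z)); rewrite Im_conjC => e.
by apply/eqP; move: e; move: (complex.Im _) => x e; lra.
Qed.

End adjoint.

(** * Block structure and completion of squares *)

Lemma adj_block_mx (R : realType) p q r s (A : 'M[R[i]]_(p, q)) (B : 'M[R[i]]_(p, r))
    (D : 'M[R[i]]_(s, q)) (F : 'M[R[i]]_(s, r)) :
  (block_mx A B D F) ^t* = block_mx (A ^t*) (D ^t*) (B ^t*) (F ^t*).
Proof. by rewrite tr_block_mx map_block_mx. Qed.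

Section completion_of_squares.
Variables (R : realType) (n mu mw : nat).
Local Notation C := R[i].
Local Notation mat := 'M[C]_(n + (mu + mw)).
Implicit Types (I X : mat) (Ku : 'M[C]_(mu, n)) (Kw : 'M[C]_(mw, n)).

Lemma stateE X : state X = ulsubmx X.
Proof.
rewrite /state /Emx adj_row_mx adjmx1 adjmx0 -{1}(submxK X).
by rewrite mul_row_block !mul1mx !mul0mx !addr0 mul_row_col mulmx1 mulmx0 addr0.
Qed.

Lemma ip_lift (M : 'M[C]_n) X :
  ip ((Emx R n mu mw) ^t* *m M *m Emx R n mu mw) X = ip M (state X).
Proof. exact: ip_congr. Qed.

Lemma psd_state X : psd X -> psd (state X).
Proof. exact: psd_congr. Qed.

(** The deviation of the inputs from the feedback [K]: it maps the stacked
    vector (x, u, w) to (u, w) - K x. *)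
Definition deviation (K : 'M[C]_(mu + mw, n)) : 'M[C]_(mu + mw, n + (mu + mw)) :=
  row_mx (- K) 1%:M.

(** For a saddle gain the range condition turns the pseudoinverse term of the
    Riccati equation into the quadratic term of [K] in the Isaacs block, so
    completing the square leaves nothing in the state block. *)
Lemma completion_of_squares I Ku Kw (K := col_mx Ku Kw) :
  I \is hermsymmx -> riccati I -> saddle_set I Ku Kw ->
  I = (deviation K) ^t* *m isaacs_block I *m deviation K.
Proof.
move=> /hermP hI [r1 r2 _]; rewrite /saddle_set -/K => hs.
rewrite /blk11 /blk1g /isaacs_block in r1 r2 hs *.
have EI : I = block_mx (ulsubmx I) (ursubmx I) ((ursubmx I) ^t*) (drsubmx I).
  rewrite -[LHS]submxK; congr block_mx.
  by rewrite -[in LHS]hI; apply/matrixP => i j; rewrite !mxE.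
have hG : (drsubmx I) ^t* = drsubmx I.
  by rewrite -[in RHS]hI; apply/matrixP => i j; rewrite !mxE.
set G := drsubmx I in r1 r2 hs hG EI *.
have e1 : (ursubmx I) ^t* = - (G *m K).
  by apply/eqP; rewrite -addr_eq0 addrC hs.
have e2 : ursubmx I = - (K ^t* *m G).
  by rewrite -[LHS]trmxCK e1 adjmxN adjmxM hG.
have e3 : ulsubmx I = K ^t* *m G *m K.
  move/eqP: r1; rewrite subr_eq0 => /eqP ->.
  rewrite {1}e2 !mulNmx -!mulmxA [G *m (_ *m _)]mulmxA r2 e1 mulmxN opprK.
  by rewrite mulmxA.
rewrite [LHS]EI e1 e2 e3 /deviation adj_row_mx adjmxN adjmx1.
rewrite mul_col_mx mul1mx mul_col_row.
by rewrite !mulmx1 !mulNmx !mulmxN !opprK.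
Qed.

(** Read [X] as the second moment of a state, a control and a disturbance: the
    three factors stand for these vectors, and constraints on the blocks of [X]
    become relations between the factors. *)
Lemma psd_blocks X : psd X -> exists (B1 : 'M[C]_(n, n + (mu + mw)))
    (Bu : 'M[C]_(mu, n + (mu + mw))) (Bw : 'M[C]_(mw, n + (mu + mw))),
  X = col_mx B1 (col_mx Bu Bw) *m (col_mx B1 (col_mx Bu Bw)) ^t*.
Proof.
move=> /psd_factor[B ->].
exists (usubmx B), (usubmx (dsubmx B)), (dsubmx (dsubmx B)).
by rewrite !vsubmxK.
Qed.

Lemma gram_blockE p (B1 : 'M[C]_(n, p)) (Bu : 'M[C]_(mu, p)) (Bw : 'M[C]_(mw, p))
    (X := col_mx B1 (col_mx Bu Bw) *m (col_mx B1 (col_mx Bu Bw)) ^t*) :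
  [/\ state X = B1 *m B1 ^t*, X12 X = Bu *m B1 ^t*, X13 X = Bw *m B1 ^t* &
   [/\ X22 X = Bu *m Bu ^t*, X23 X = Bw *m Bu ^t* & X33 X = Bw *m Bw ^t*]].
Proof.
rewrite stateE /X12 /X13 /X22 /X23 /X33 /X !adj_col_mx mul_col_row.
rewrite block_mxKul block_mxKdl block_mxKdr mul_col_mx col_mxKu col_mxKd.
by rewrite mul_col_row !block_mxKul !block_mxKdl !block_mxKdr.
Qed.

(** A player whose second moments are those of the linear feedback [K] plays
    exactly [K]: the residual has zero Gram matrix. *)
Lemma gram_feedback p q r (B1 : 'M[C]_(p, r)) (B2 : 'M[C]_(q, r))
    (K : 'M[C]_(q, p)) :
  B2 *m B1 ^t* = K *m (B1 *m B1 ^t*) ->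
  B2 *m B2 ^t* = K *m (B1 *m B1 ^t*) *m K ^t* -> B2 = K *m B1.
Proof.
move=> e1 e2; apply/eqP; rewrite -subr_eq0; apply/eqP; apply: gram_eq0.
rewrite adjmxD adjmxN adjmxM mulmxBl !mulmxBr e2 (mulmxA B2) e1.
have e1' : B1 *m B2 ^t* = B1 *m B1 ^t* *m K ^t*.
  by rewrite -[LHS]trmxCK adjmxM trmxCK e1 !adjmxM trmxCK.
by rewrite -(mulmxA K B1 (B2 ^t*)) e1' !mulmxA !subrr.
Qed.

Lemma ip_completion I Ku Kw p (B1 : 'M[C]_(n, p)) (Bg : 'M[C]_(mu + mw, p))
    (D := Bg - col_mx Ku Kw *m B1) :
  I \is hermsymmx -> riccati I -> saddle_set I Ku Kw ->
  ip I (col_mx B1 Bg *m (col_mx B1 Bg) ^t*) = ip (isaacs_block I) (D *m D ^t*).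
Proof.
move=> hI rI sI; rewrite {1}(completion_of_squares hI rI sI) ip_congr.
set V := col_mx B1 Bg; have EV : deviation (col_mx Ku Kw) *m V = D.
  by rewrite /deviation mul_row_col mul1mx mulNmx addrC.
rewrite (mulmxA (deviation _) V) EV -(mulmxA D (V ^t*)) -adjmxM EV.
by [].
Qed.

Lemma ip_corner_dr p (G : 'M[C]_(mu + mw)) (D : 'M[C]_(mw, p)) :
  ip G (col_mx 0 D *m (col_mx 0 D) ^t*) = ip (drsubmx G) (D *m D ^t*).
Proof.
rewrite !ip_gram adj_col_mx adjmx0 -{1}[G]submxK mul_row_block.
by rewrite !mul0mx !add0r mul_row_col mulmx0 add0r.
Qed.

Lemma ip_corner_ul p (G : 'M[C]_(mu + mw)) (D : 'M[C]_(mu, p)) :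
  ip G (col_mx D 0 *m (col_mx D 0) ^t*) = ip (ulsubmx G) (D *m D ^t*).
Proof.
rewrite !ip_gram adj_col_mx adjmx0 -{1}[G]submxK mul_row_block.
by rewrite !mul0mx !addr0 mul_row_col mulmx0 addr0.
Qed.

(** Only the deviation of the maximizer remains, and [blkww I] is negative
    semidefinite. *)
Lemma ip_min_feedback I Ku Kw X :
  I \is hermsymmx -> riccati I -> saddle_set I Ku Kw -> psd X ->
  X12 X = Ku *m state X -> X22 X = Ku *m state X *m Ku ^t* -> ip I X <= 0.
Proof.
move=> hI rI sI /psd_blocks[B1 [Bu [Bw ->]]].
have [-> -> _ [-> _ _]] := gram_blockE B1 Bu Bw => e1 e2.
rewrite (ip_completion _ _ hI rI sI).
rewrite mul_col_mx opp_col_mx add_col_mx (gram_feedback e1 e2) subrr.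
set D := _ - _; case: rI => _ _ [[_ pw] _ _ _ _].
by have := psd_ip_ge0 D pw; rewrite ipNl oppr_ge0 ip_corner_dr.
Qed.

(** Only the deviation of the minimizer remains, and [blkuu I] is positive
    semidefinite. *)
Lemma ip_max_feedback I Ku Kw X :
  I \is hermsymmx -> riccati I -> saddle_set I Ku Kw -> psd X ->
  X13 X = Kw *m state X -> X33 X = Kw *m state X *m Kw ^t* -> 0 <= ip I X.
Proof.
move=> hI rI sI /psd_blocks[B1 [Bu [Bw ->]]].
have [-> _ -> [_ _ ->]] := gram_blockE B1 Bu Bw => e1 e2.
rewrite (ip_completion _ _ hI rI sI).
rewrite mul_col_mx opp_col_mx add_col_mx (gram_feedback e1 e2) subrr.
set D := _ - _; case: rI => _ _ [[pu _] _ _ _ _].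
by have := psd_ip_ge0 D pu; rewrite ip_corner_ul.
Qed.

Lemma lift_gains_blocks Ku Kw (Y : 'M[C]_n) (X := lift_gains Ku Kw Y) :
  psd Y ->
  [/\ psd X, state X = Y, X12 X = Ku *m Y, X13 X = Kw *m Y &
   [/\ X22 X = Ku *m Y *m Ku ^t*, X23 X = Kw *m (Ku *m Y) ^t* &
       X33 X = Kw *m Y *m Kw ^t*]].
Proof.
move=> pY; have pX : psd X by exact: psd_congr.
move: pY => /psd_factor[B EB]; split=> //; rewrite /X;
  have -> : lift_gains Ku Kw Y =
    col_mx B (col_mx (Ku *m B) (Kw *m B)) *m
    (col_mx B (col_mx (Ku *m B) (Kw *m B)))^t*
  by rewrite /lift_gains EB mulmxA -mulmxA -adjmxM !mul_col_mx mul1mx.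
- by case: (gram_blockE B (Ku *m B) (Kw *m B)) => ->.
- by case: (gram_blockE B (Ku *m B) (Kw *m B)) => _ -> _ _; rewrite EB mulmxA.
- by case: (gram_blockE B (Ku *m B) (Kw *m B)) => _ _ -> _; rewrite EB mulmxA.
- case: (gram_blockE B (Ku *m B) (Kw *m B)) => _ _ _ [-> -> ->].
  by rewrite EB !adjmxM trmxCK !mulmxA.
Qed.

Lemma psd_state_min_block (Ku : 'M[C]_(mu, n)) (Y : 'M[C]_n) :
  psd Y -> psd (state_min_block Y (Ku *m Y, Ku *m Y *m Ku ^t*)).
Proof.
move=> pY; rewrite /state_min_block /=.
suff -> : block_mx Y ((Ku *m Y)^t*) (Ku *m Y) (Ku *m Y *m Ku ^t*) =
  col_mx 1%:M Ku *m Y *m (col_mx 1%:M Ku)^t* by exact: psd_congr.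
rewrite mul_col_mx mul1mx adj_col_mx adjmx1 mul_col_row !mulmx1.
by rewrite adjmxM (proj1 (hermP _) (proj1 pY)).
Qed.

(** The disturbance is [Kw] times the state, so the whole matrix is a congruence
    of the blocks known to the maximizer, by (x, u) to (x, u, Kw x). *)
Lemma psd_assemble Kw (Y : 'M[C]_n) (U : 'M[C]_(mu, n) * 'M[C]_mu) :
  psd (state_min_block Y U) ->
  psd (assemble Y U (Kw *m Y, Kw *m Y *m Kw ^t*) (Kw *m U.1 ^t*)).
Proof.
rewrite /state_min_block /assemble /= => pS; have /hermP hS := proj1 pS.
have hY : Y ^t* = Y.
  by have := congr1 (@ulsubmx _ _ _ _ _) hS; rewrite tr_block_mx map_block_mx !block_mxKul.
set S := block_mx _ _ _ _ in pS.
suff -> : block_mx Y (row_mx (U.1 ^t*) ((Kw *m Y)^t*)) (col_mx U.1 (Kw *m Y))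
   (block_mx U.2 ((Kw *m U.1 ^t*)^t*) (Kw *m U.1 ^t*) (Kw *m Y *m Kw ^t*)) =
  block_mx 1%:M 0 (col_mx 0 Kw) (col_mx 1%:M 0) *m S *m
  (block_mx 1%:M 0 (col_mx 0 Kw) (col_mx 1%:M 0))^t* by exact: psd_congr.
rewrite /S mulmx_block !mul1mx !mul0mx !addr0 !mul_col_mx !mul1mx !mul0mx.
rewrite !add_col_mx !addr0 !add0r.
rewrite adj_block_mx.
rewrite !adj_col_mx !adjmx1 !adjmx0 !mul_row_block !mulmx1 !mulmx0 !addr0.
rewrite !mul_mx_row !mulmx0 !mulmx1 !add_row_mx !add0r !addr0.
rewrite !adjmxM trmxCK hY /block_mx; congr (col_mx _ (row_mx _ _)).
by rewrite mul_col_mx -block_mxEh.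
Qed.

End completion_of_squares.

(** * Piecewise continuous functions *)

Section piecewise.
Variable R : realType.
Implicit Types (a b c d t : R) (f g : R -> R).
Local Notation mes := (@lebesgue_measure R).

Lemma near_itvoo c d t : c < t < d -> \forall x \near t, c < x < d.
Proof. by move=> h; have := @near_in_itvoo R c d t; rewrite !in_itv; exact. Qed.

Lemma right_itvoo c d : c < d -> \forall x \near c^'+, c < x < d.
Proof.
move=> cd; near=> x; apply/andP; split; near: x; first exact: nbhs_right_gt.
exact: nbhs_right_lt.
Unshelve. all: by end_near. Qed.

Lemma left_itvoo c d : c < d -> \forall x \near d^'-, c < x < d.
Proof.
move=> cd; near=> x; apply/andP; split; near: x; first exact: nbhs_left_gt.
exact: nbhs_left_lt.
Unshelve. all: by end_near. Qed.

Lemma cvg_near_eq (F : set_system R) (FF : Filter F) f g (l : set_system R) :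
  (\forall x \near F, f x = g x) -> f x @[x --> F] --> l -> g x @[x --> F] --> l.
Proof. by move=> fg fl; apply: cvg_trans fl; exact: near_eq_cvg. Qed.

(** The device that handles discontinuities and jumps throughout: induction on
    the exceptional points inside the interval. *)
Lemma itv_glue a b (D : seq R) (Q : R -> R -> Prop) :
  (forall c m d, a <= c -> c < m -> m < d -> d <= b -> Q c m -> Q m d -> Q c d) ->
  (forall c d, a <= c -> c < d -> d <= b ->
     (forall t, c < t < d -> t \notin D) -> Q c d) ->
  forall c d, a <= c -> c < d -> d <= b -> Q c d.
Proof.
move=> glue base.
suff H (l : seq R) c d : a <= c -> c < d -> d <= b ->
    (forall t, c < t < d -> t \in D -> t \in l) -> Q c d.
  by move=> c d ac cd db; apply: (H D c d ac cd db).
elim: l c d => [|x l IH] c d ac cd db sub.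
  by apply: base => // t ct; apply/negP => /(sub _ ct).
have [/andP[cx xd]|ncxd] := boolP (c < x < d).
  apply: (glue c x d) => //; apply: IH => //.
  - exact: le_trans (ltW xd) db.
  - move=> t /andP[ct tx] tD; have := sub t; rewrite ct (lt_trans tx xd) inE.
    by move=> /(_ isT tD); rewrite (lt_eqF tx).
  - exact: le_trans ac (ltW cx).
  - move=> t /andP[xt td] tD; have := sub t; rewrite (lt_trans cx xt) td inE.
    by move=> /(_ isT tD); rewrite (gt_eqF xt).
apply: IH => // t ct tD; have := sub t ct tD; rewrite inE => /orP[/eqP tx|//].
by move: ncxd; rewrite -tx ct.
Qed.

(** Between two exceptional points this substitutes a bounded continuous function
    for a piecewise continuous one, whose values at the end points are
    arbitrary. *)
Lemma continuous_extension c d f : c < d ->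
  (forall t, c < t < d -> {for t, continuous f}) ->
  cvg (f x @[x --> c^'+]) -> cvg (f x @[x --> d^'-]) ->
  exists g, [/\ continuous g, forall t, c < t < d -> g t = f t,
    f x @[x --> c^'+] --> g c, f x @[x --> d^'-] --> g d &
    exists M, forall t, `|g t| <= M].
Proof.
move=> cd cf /cvg_ex[/= l fl] /cvg_ex[/= r fr].
pose g t := if t <= c then l else if d <= t then r else f t.
have gl t : t <= c -> g t = l by rewrite /g => ->.
have gr t : d <= t -> g t = r.
  by move=> dt; rewrite /g dt leNgt (lt_le_trans cd dt).
have gm t : c < t < d -> g t = f t.
  by move=> /andP[ct td]; rewrite /g leNgt ct leNgt td.
move: g gl gr gm => g gl gr gm.
have cg : continuous g.
  move=> t; have [tc|ct] := ltP t c.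
    rewrite /continuous_at (gl t (ltW tc)).
    apply: (@cvg_near_eq _ _ (cst l)); last exact: cvg_cst.
    near=> x; rewrite gl//; apply: ltW; near: x; exact: lt_nbhsl.
  have [td|dt] := ltP d t.
    rewrite /continuous_at (gr t (ltW td)).
    apply: (@cvg_near_eq _ _ (cst r)); last exact: cvg_cst.
    near=> x; rewrite gr//; apply: ltW; near: x; exact: lt_nbhsr.
  have [tc|ct'] := eqVneq t c.
    apply/left_right_continuousP; rewrite tc gl//; split.
      apply: (@cvg_near_eq _ _ (cst l)); last exact: cvg_cst.
      near=> x; rewrite gl//; apply: ltW; near: x; exact: nbhs_left_lt.
    apply: cvg_near_eq fl; near=> x; rewrite gm//.
    by near: x; exact: right_itvoo.
  have [td|dt'] := eqVneq t d.
    apply/left_right_continuousP; rewrite td gr//; split.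
      apply: cvg_near_eq fr; near=> x; rewrite gm//.
      by near: x; exact: left_itvoo.
    apply: (@cvg_near_eq _ _ (cst r)); last exact: cvg_cst.
    near=> x; rewrite gr//; apply: ltW; near: x; exact: nbhs_right_gt.
  have ctd : c < t < d by rewrite !lt_neqAle (eq_sym c) ct' ct dt' dt.
  rewrite /continuous_at gm//; apply: cvg_near_eq (cf _ ctd).
  by near=> x; rewrite gm//; near: x; exact: near_itvoo.
have cgw : {within `[c, d], continuous g} by exact: continuous_subspaceT.
have [u ucd gu] := EVT_max (ltW cd) cgw.
have [v vcd gv] := EVT_min (ltW cd) cgw.
exists g; split=> //; first by rewrite gl.
  by rewrite gr.
exists (`|g u| + `|g v|) => t.
wlog tcd : t / c <= t <= d.
  move=> H; have [tc|ct] := leP t c; first by rewrite gl// -(gl c)// H// lexx ltW.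
  have [td|dt] := leP d t; first by rewrite gr// -(gr d)// H// lexx ltW.
  by apply: H; rewrite !ltW.
have := gu t; have := gv t; rewrite !in_itv tcd => /(_ isT) hv /(_ isT) hu.
rewrite ler_norml; apply/andP; split.
  rewrite lerNl; apply: (@le_trans _ _ (- g v)); first by rewrite lerN2.
  by rewrite (le_trans (ler_norm _))// normrN lerDr.
by rewrite (le_trans hu)// (le_trans (ler_norm _))// lerDl.
Unshelve. all: by end_near. Qed.

Lemma pw_extension a b f (D : seq R) c d :
  (forall t, a < t < b -> t \notin D -> {for t, continuous f}) ->
  (forall t, a <= t < b -> cvg (f x @[x --> t^'+])) ->
  (forall t, a < t <= b -> cvg (f x @[x --> t^'-])) ->
  a <= c -> c < d -> d <= b -> (forall t, c < t < d -> t \notin D) ->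
  exists g, [/\ continuous g, forall t, c < t < d -> g t = f t,
    f x @[x --> c^'+] --> g c, f x @[x --> d^'-] --> g d &
    exists M, forall t, `|g t| <= M].
Proof.
move=> cf rf lf ac cd db noD; apply: continuous_extension => //.
- move=> t ctd; apply: cf; last exact: noD.
  by case/andP: ctd => ct td; rewrite (le_lt_trans ac ct) (lt_le_trans td db).
- by apply: rf; rewrite ac (lt_le_trans cd db).
- by apply: lf; rewrite db (le_lt_trans ac cd).
Qed.

Lemma pw_bounded a b f : a < b -> pw_continuous a b f ->
  exists M, forall t, a <= t <= b -> `|f t| <= M.
Proof.
move=> ab [D [cf rf lf]].
apply: (@itv_glue a b D (fun c d => exists M, forall t, c <= t <= d -> `|f t| <= M));
  rewrite ?lexx//.
  move=> c m d _ cm md _ [M hM] [N hN]; exists (Num.max M N) => t /andP[ct td].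
  rewrite le_max; have [tm|mt] := leP t m; first by rewrite hM ?ct.
  by rewrite hN ?orbT// td ltW.
move=> c d ac cd db noD.
have [g [_ gf _ _ [M gM]]] := pw_extension cf rf lf ac cd db noD.
exists (Num.max M (Num.max `|f c| `|f d|)) => t; rewrite !le_max.
rewrite le_eqVlt => /andP[/predU1P[<-|ct]]; first by rewrite lexx orbT.
rewrite le_eqVlt => /predU1P[->|td]; first by rewrite lexx !orbT.
by rewrite -gf ?ct// gM.
Qed.

Lemma itvcc_set1U c d : c < d ->
  `[c, d]%classic = ([set c] `|` `]c, d[) `|` [set d].
Proof.
move=> cd; apply/seteqP; split=> t /=; rewrite !in_itv /=.
  case/andP; rewrite le_eqVlt => /predU1P[->|ct]; first by left; left.
  rewrite le_eqVlt => /predU1P[->|td]; first by right.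
  by left; right; rewrite ct.
by move=> [[->|/andP[ct td]]|->]; rewrite ?lexx ?ltW.
Qed.

Lemma pw_measurable a b f : a < b -> pw_continuous a b f ->
  measurable_fun `[a, b] f.
Proof.
move=> ab [D [cf rf lf]].
apply: (@itv_glue a b D (fun c d => measurable_fun `[c, d] f)); rewrite ?lexx//.
  move=> c m d _ cm md _ mf mg.
  have -> : `[c, d]%classic = `[c, m] `|` `[m, d].
    apply/seteqP; split=> t /=; rewrite !in_itv /=.
      by move=> /andP[ct td]; have [tm|/ltW mt] := leP t m; [left|right];
        rewrite ?ct ?td ?mt.
    move=> [/andP[ct tm]|/andP[mt td]]; first by rewrite ct (le_trans tm)// ltW.
    by rewrite td (le_trans _ mt)// ltW.
  by apply/measurable_funU.
move=> c d ac cd db noD.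
have [g [cg gf _ _ _]] := pw_extension cf rf lf ac cd db noD.
rewrite (itvcc_set1U cd); apply/measurable_funU => //.
  exact: measurableU.
split; last exact: measurable_fun_set1.
apply/measurable_funU => //; split; first exact: measurable_fun_set1.
apply: (@eq_measurable_fun _ _ _ _ _ g).
  by move=> t; rewrite inE /= in_itv /= => h; rewrite gf.
apply: subspace_continuous_measurable_fun => //.
exact: continuous_subspaceT.
Qed.

Lemma pw_integrable a b f : a < b -> pw_continuous a b f ->
  mes.-integrable `[a, b] (EFin \o f).
Proof.
move=> ab pf; apply: measurable_bounded_integrable => //.
- by rewrite /= lebesgue_measure_itv /= lte_fin ab -EFinB ltry.
- exact: pw_measurable.
- have [M hM] := pw_bounded ab pf; exists M; split; first exact: num_real.
  by move=> x Mx t; rewrite /= in_itv /= => /hM /le_trans; apply; exact: ltW.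
Qed.

Lemma pw_sub a b c d f : a <= c -> d <= b -> pw_continuous a b f ->
  pw_continuous c d f.
Proof.
move=> ac db [D [cf rf lf]]; exists D; split=> t /andP[ct td].
- by apply: cf; rewrite (le_lt_trans ac ct) (lt_le_trans td db).
- by apply: rf; rewrite (le_trans ac ct) (lt_le_trans td db).
- by apply: lf; rewrite (le_lt_trans ac ct) (le_trans td db).
Qed.

Lemma pw_cst a b (k : R) : pw_continuous a b (fun _ => k).
Proof.
exists [::]; split=> t _ *; last 2 first.
- exact: is_cvg_cst.
- exact: is_cvg_cst.
by move=> ?; exact: cvg_cst.
Qed.

Lemma pwD a b f g : pw_continuous a b f -> pw_continuous a b g ->
  pw_continuous a b (fun t => f t + g t).
Proof.
move=> [D [cf rf lf]] [E [cg rg lg]]; exists (D ++ E); split=> t abt.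
- rewrite mem_cat negb_or => /andP[tD tE].
  by apply: cvgD; [exact: cf|exact: cg].
- by apply: is_cvgD; [exact: rf|exact: rg].
- by apply: is_cvgD; [exact: lf|exact: lg].
Qed.

Lemma pwM a b f g : pw_continuous a b f -> pw_continuous a b g ->
  pw_continuous a b (fun t => f t * g t).
Proof.
move=> [D [cf rf lf]] [E [cg rg lg]]; exists (D ++ E); split=> t abt.
- rewrite mem_cat negb_or => /andP[tD tE].
  by apply: cvgM; [exact: cf|exact: cg].
- by apply: is_cvgM; [exact: rf|exact: rg].
- by apply: is_cvgM; [exact: lf|exact: lg].
Qed.

Lemma pwN a b f : pw_continuous a b f -> pw_continuous a b (fun t => - f t).
Proof.
move=> pf; have -> : (fun t => - f t) = (fun t => -1 * f t).
  by apply/funext => t; rewrite mulN1r.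
exact: pwM (pw_cst _ _ _) pf.
Qed.

Lemma pw_sum a b I (r : seq I) (Q : pred I) (F : I -> R -> R) :
  (forall i, pw_continuous a b (F i)) ->
  pw_continuous a b (fun t => \sum_(i <- r | Q i) F i t).
Proof.
move=> pF; elim: r => [|i r IH].
  by under eq_fun do rewrite big_nil; exact: pw_cst.
by under eq_fun do rewrite big_cons; case: (Q i) => //; exact: pwD.
Qed.

Lemma pw_within a b f : a < b -> {within `[a, b], continuous f} ->
  pw_continuous a b f.
Proof.
move=> ab /(continuous_within_itvP f ab)[cf rf lf]; exists [::]; split=> t.
- by move=> abt _; apply: cf; rewrite in_itv.
- case/andP; rewrite le_eqVlt => /predU1P[<- _|at_ tb].
    by apply/cvg_ex; exists (f a).
  apply/cvg_ex; exists (f t); apply: cvg_at_right_filter; apply: cf.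
  by rewrite in_itv /= at_.
- case/andP => at_; rewrite le_eqVlt => /predU1P[->|tb].
    by apply/cvg_ex; exists (f b).
  apply/cvg_ex; exists (f t); apply: cvg_at_left_filter; apply: cf.
  by rewrite in_itv /= at_.
Qed.

End piecewise.

(** * The fundamental theorem of calculus with jumps; linear differential equations *)

Lemma cvg_sumr (R : realType) T (F : set_system T) (FF : Filter F) I (r : seq I)
    (f : I -> T -> R) (l : I -> R) :
  (forall i, f i x @[x --> F] --> l i) ->
  (\sum_(i <- r) f i x) @[x --> F] --> \sum_(i <- r) l i.
Proof.
move=> fl; elim: r => [|i r IH].
  by rewrite big_nil; under eq_fun do rewrite big_nil; exact: cvg_cst.
by rewrite big_cons; under eq_fun do rewrite big_cons; exact: cvgD (fl i) IH.
Qed.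

Lemma is_derive_sumr (R : realType) I (r : seq I) (f : I -> R -> R) (t : R)
    (df : I -> R) :
  (forall i, is_derive t 1 (f i) (df i)) ->
  is_derive t 1 (fun x => \sum_(i <- r) f i x) (\sum_(i <- r) df i).
Proof.
move=> fd; elim: r => [|i r IH].
  by rewrite big_nil; under eq_fun do rewrite big_nil; exact: is_derive_cst.
by rewrite big_cons; under eq_fun do rewrite big_cons; exact: is_deriveD (fd i) IH.
Qed.

Section fundamental_theorem.
Variable R : realType.
Implicit Types (a b c d t : R) (f g : R -> R).
Local Notation mes := (@lebesgue_measure R).

Lemma Rintegral_itv_oo c d f : mes.-integrable `[c, d] (EFin \o f) ->
  \int[mes]_(t in `[c, d]) f t = \int[mes]_(t in `]c, d[) f t.
Proof.
move=> fi; rewrite -Rintegral_itv_obnd_cbnd; last first.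
  by apply: integrableS fi => //; exact: subset_itv_oc_cc.
rewrite -Rintegral_itv_bndo_bndc//.
by apply: integrableS fi => //; exact: subset_itv_oo_cc.
Qed.

Lemma Rintegral_itv_split c m d f : c < m -> m < d ->
  mes.-integrable `[c, d] (EFin \o f) ->
  \int[mes]_(t in `[c, d]) f t =
  \int[mes]_(t in `[c, m]) f t + \int[mes]_(t in `[m, d]) f t.
Proof.
move=> cm md fi; have := @Rintegral_itvB _ f (BLeft c) (BRight d) m fi.
rewrite !bnd_simp => /(_ (ltW cm) (ltW md)) e; rewrite -(subrK (\int[mes]_(t in `[c, m]) f t)
  (\int[mes]_(t in `[c, d]) f t)) e addrC; congr (_ + _).
apply: Rintegral_itv_obnd_cbnd; apply: integrableS fi => //.
by apply: subset_itvr => /=; rewrite bnd_simp ltW.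
Qed.

(** Intervals free of exceptional points are covered by the theorem for
    continuous derivatives; where two of them meet, the one-sided limits of [V]
    differ by the jumps located there. *)
Lemma FTC_jumps a b (V v Vl Vr : R -> R) (D : seq R) N (tk Delta : nat -> R) :
  a < b -> pw_continuous a b v ->
  (forall t, a < t < b -> t \notin D -> is_derive t 1 V (v t)) ->
  (forall t, a <= t < b -> V x @[x --> t^'+] --> Vr t) ->
  (forall t, a < t <= b -> V x @[x --> t^'-] --> Vl t) ->
  (forall t, a < t < b -> Vr t - Vl t = \sum_(k < N | tk k == t) Delta k) ->
  Vl b - Vr a =
  \int[mes]_(t in `[a, b]) v t + \sum_(k < N | a < tk k < b) Delta k.
Proof.
move=> ab pv dV VR VL J; have [Dv [cv rv lv]] := pv.
pose tks := [seq tk k | k <- iota 0 N].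
apply: (@itv_glue R a b (D ++ Dv ++ tks) (fun c d => Vl d - Vr c =
  \int[mes]_(t in `[c, d]) v t + \sum_(k < N | c < tk k < d) Delta k));
  rewrite ?lexx//.
  move=> c m d ac cm md db e1 e2; rewrite (@Rintegral_itv_split c m d)//; last first.
    by apply: pw_integrable (pw_sub ac db pv); exact: lt_trans md.
  have am : a < m < b by rewrite (le_lt_trans ac cm) (lt_le_trans md db).
  have -> : Vl d - Vr c = (Vl m - Vr c) + (Vr m - Vl m) + (Vl d - Vr m) by ring.
  rewrite e1 e2 (J _ am).
  have -> : \sum_(k < N | c < tk k < d) Delta k = \sum_(k < N | c < tk k < m) Delta k
     + \sum_(k < N | tk k == m) Delta k + \sum_(k < N | m < tk k < d) Delta k.
    rewrite [LHS]big_mkcond [X in _ = X + _ + _]big_mkcond.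
    rewrite [X in _ = _ + X + _]big_mkcond [X in _ = _ + _ + X]big_mkcond.
    rewrite -!big_split /=; apply: eq_bigr => k _.
    case: (ltgtP (tk k) m) => [tm|mt|->].
    - by rewrite (lt_trans tm md) !addr0.
    - by rewrite (lt_trans cm mt) andbF !add0r.
    - by rewrite cm md andbF add0r addr0.
  by ring.
move=> c d ac cd db noD.
have noDV t : c < t < d -> t \notin D.
  by move=> /noD; rewrite mem_cat negb_or => /andP[].
have noDv t : c < t < d -> t \notin Dv.
  by move=> /noD; rewrite !mem_cat !negb_or => /and3P[].
have in_ab t : c < t < d -> a < t < b.
  by move=> /andP[ct td]; rewrite (le_lt_trans ac ct) (lt_le_trans td db).
rewrite big_pred0 ?addr0; last first.
  move=> k; apply/negbTE/negP => /noD; rewrite !mem_cat !negb_or => /and3P[_ _].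
  by move=> /negP; apply; apply: map_f; rewrite mem_iota /= add0n.
have [w [cw wv _ _ _]] := pw_extension cv rv lv ac cd db noDv.
have cV t : c < t < d -> {for t, continuous V}.
  move=> ctd; have dVt := dV t (in_ab t ctd) (noDV t ctd).
  by apply: differentiable_continuous; apply/derivable1_diffP; exact: ex_derive.
have VRc : V x @[x --> c^'+] --> Vr c by apply: VR; rewrite ac (lt_le_trans cd db).
have VLd : V x @[x --> d^'-] --> Vl d by apply: VL; rewrite db (le_lt_trans ac cd).
have [W [cW WV Wc Wd _]] : exists g, [/\ continuous g, forall t, c < t < d -> g t = V t,
    V x @[x --> c^'+] --> g c, V x @[x --> d^'-] --> g d &
    exists M, forall t, `|g t| <= M].
  by apply: continuous_extension => //; apply/cvg_ex; [exists (Vr c)|exists (Vl d)].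
have -> : Vl d = W d by exact: (cvg_unique _ VLd Wd).
have -> : Vr c = W c by exact: (cvg_unique _ VRc Wc).
have dW t : c < t < d -> is_derive t 1 W (v t).
  move=> ctd; apply: (@near_eq_is_derive _ _ _ V); last exact: dV (in_ab t ctd) (noDV t ctd).
  by near=> x; rewrite WV//; near: x; exact: near_itvoo.
rewrite Rintegral_itv_oo; last first.
  by apply: pw_integrable => //; exact: pw_sub ac db pv.
have -> : \int[mes]_(t in `]c, d[) v t = \int[mes]_(t in `]c, d[) w t.
  by apply: eq_Rintegral => t; rewrite inE /= in_itv /= => /wv.
rewrite -Rintegral_itv_oo; last first.
  apply: continuous_compact_integrable; first exact: segment_compact.
  exact: continuous_subspaceT.
rewrite /Rintegral (@continuous_FTC2 _ w W c d)//.
- exact: continuous_subspaceT.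
- split=> [t|//|//]; rewrite ?in_itv /=.
  + by move=> /dW h; exact: ex_derive.
  + by apply: cvg_at_right_filter; exact: cW.
  + by apply: cvg_at_left_filter; exact: cW.
- by move=> t; rewrite in_itv /= => ct; have h := dW t ct; rewrite derive1E derive_val wv.
Unshelve. all: by end_near. Qed.

End fundamental_theorem.

Section linear_ode.
Variable R : realType.
Local Notation mes := (@lebesgue_measure R).

Definition primitive (s : R) (f : R -> R) (t : R) : R :=
  parameterized_integral mes s t f.

Lemma continuous_itv_integrable (f : R -> R) s e :
  continuous f -> mes.-integrable `[s, e] (EFin \o f).
Proof.
move=> cf; apply: continuous_compact_integrable; first exact: segment_compact.
exact: continuous_subspaceT.
Qed.

Lemma primitive_le (s : R) f t : t <= s -> primitive s f t = 0.
Proof.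
rewrite /primitive /parameterized_integral le_eqVlt => /predU1P[->|ts].
  by rewrite set_itv1 Rintegral_set1.
by rewrite set_itv_ge ?Rintegral_set0// bnd_simp -ltNge.
Qed.

Lemma primitive_is_derive (s : R) f t : continuous f -> s < t ->
  is_derive t 1 (primitive s f) (f t).
Proof.
move=> cf st; have t1 : t < t + 1 by rewrite ltrDl.
have [d e] := continuous_FTC1_closed t1 (continuous_itv_integrable s (t + 1) cf) st (cf t).
by apply: DeriveDef; [exact: d|rewrite -derive1E; exact: e].
Qed.

Lemma primitive_continuous (s : R) f : continuous f -> continuous (primitive s f).
Proof.
move=> cf t; have [ts|st|->] := ltgtP t s.
- rewrite /continuous_at (primitive_le _ (ltW ts)).
  apply: (@cvg_near_eq _ _ _ (cst 0)); last exact: cvg_cst.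
  near=> x; apply/esym/primitive_le; apply: ltW; near: x; exact: lt_nbhsl.
- have h := primitive_is_derive cf st.
  by apply: differentiable_continuous; apply/derivable1_diffP; exact: ex_derive.
- rewrite /continuous_at (primitive_le _ (lexx s)).
  have s1 : s < s + 1 by rewrite ltrDl.
  exact: (parameterized_integral_cvg_left s1 (continuous_itv_integrable s (s + 1) cf)).
Unshelve. all: by end_near. Qed.

Lemma geometric_lt (A e : R) : 0 < e -> exists k : nat, A * 2^-1 ^+ k < e.
Proof.
move=> e0; pose k := Num.bound (`|A| / e).
exists k; rewrite exprVn ltr_pdivrMr ?exprn_gt0// mulrC -ltr_pdivrMr//.
apply: (@le_lt_trans _ _ (`|A| / e)); first by rewrite ler_pM2r ?invr_gt0// ler_norm.
have : `|A| / e < k%:R by apply: archi_boundP; rewrite divr_ge0// ltW.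
move=> /lt_trans; apply.
by rewrite -natrX ltr_nat ltn_expl.
Qed.

(** The limit is the supremum of the lower bounds [u k - 2 A / 2 ^ k], which
    increase while the upper bounds [u k + 2 A / 2 ^ k] decrease. *)
Lemma geometric_limit (u : nat -> R) (A : R) :
  (forall k, `|u k.+1 - u k| <= A * 2^-1 ^+ k) ->
  exists l, forall k, `|u k - l| <= 2 * A * 2^-1 ^+ k.
Proof.
move=> du; pose r k := 2 * A * 2^-1 ^+ k.
have rS k : r k.+1 = r k - A * 2^-1 ^+ k by rewrite /r exprS; field.
have lo k : u k - r k <= u k.+1 - r k.+1.
  by have := du k; rewrite ler_norml rS => /andP[h _]; lra.
have hi k : u k.+1 + r k.+1 <= u k + r k.
  by have := du k; rewrite ler_norml rS => /andP[_ h]; lra.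
have r0 k : 0 <= r k.
  rewrite /r; apply: mulr_ge0; last by rewrite exprn_ge0// invr_ge0.
  by apply: mulr_ge0 => //; have := du 0; rewrite expr0 mulr1; exact: le_trans.
have lok j k : (j <= k)%N -> u j - r j <= u k - r k.
  by apply: (homo_leq (fun x => lexx x) le_trans lo).
have hik j k : (j <= k)%N -> u k + r k <= u j + r j.
  move=> /(homo_leq (f := fun i => - (u i + r i)) (r := <=%R) (fun x => lexx x) le_trans).
  by rewrite lerN2; apply => i; rewrite lerN2.
have ub k : ubound (range (fun j => u j - r j)) (u k + r k).
  move=> _ [j _ <-]; have [jk|/ltnW kj] := leqP j k.
    by apply: (le_trans (lok _ _ jk)); have := r0 k; lra.
  by apply: (le_trans _ (hik _ _ kj)); have := r0 j; lra.
exists (sup (range (fun j => u j - r j))) => k; rewrite distrC ler_distl.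
apply/andP; split; last by apply: ge_sup => //; exists (u 0 - r 0), 0.
by apply: ub_le_sup; [exists (u 0 + r 0); exact: ub|exists k].
Qed.

Variables (I : finType) (b : I -> I -> R -> R) (M : R) (s : R) (y0 : I -> R).
Hypothesis cb : forall i j, continuous (b i j).
Hypothesis bM : forall i j t, `|b i j t| <= M.

Implicit Types u z : I -> R -> R.

Let field (u : I -> R -> R) i t := \sum_j b i j t * u j t.
Let picard (u : I -> R -> R) i t := y0 i + primitive s (field u i) t.
Let K := #|I|%:R * `|M| + 1.
(* In this weight (Bielecki's) the Picard map halves distances on the whole
   half-line at once; it is frozen before s, where nothing evolves. *)
Let weight t := expR (2 * K * (Num.max s t - s)).

Let K_gt0 : 0 < K.
Proof. by rewrite /K ltr_pwDr// mulr_ge0. Qed.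

Let weight_ge1 t : 1 <= weight t.
Proof.
rewrite -expR0 ler_expR mulr_ge0//; first by rewrite mulr_ge0// ltW.
by rewrite subr_ge0 le_max lexx.
Qed.

Let weight_homo t t' : t <= t' -> weight t <= weight t'.
Proof.
move=> tt; rewrite ler_expR ler_pM2l ?mulr_gt0// lerD2r.
by rewrite ge_max !le_max lexx tt orbT.
Qed.

Let continuous_field u i : (forall j, continuous (u j)) -> continuous (field u i).
Proof.
move=> cu; rewrite /field => t; apply: cvg_sumr => j.
by apply: cvgM; [exact: cb|exact: cu].
Qed.

Let continuous_picard u i : (forall j, continuous (u j)) -> continuous (picard u i).
Proof.
move=> cu t; apply: cvgD; first exact: cvg_cst.
by apply: primitive_continuous; exact: continuous_field.
Qed.

Let field_dist u z (d : R) i t :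
  (forall j, `|u j t - z j t| <= d) -> `|field u i t - field z i t| <= K * d.
Proof.
move=> uz; rewrite /field -sumrB; apply: (le_trans (ler_norm_sum _ _ _)).
have d0 : 0 <= d by exact: le_trans (normr_ge0 _) (uz i).
apply: (@le_trans _ _ (\sum_(j : I) `|M| * d)).
  apply: ler_sum => j _; rewrite -mulrBr normrM ler_pM//.
  exact: le_trans (bM i j t) (ler_norm M).
by rewrite sumr_const -mulr_natl mulrA /K mulrDl mul1r lerDl.
Qed.

Let picard_contraction_le u z (d : R) i t : 0 <= d ->
  (forall j, continuous (u j)) -> (forall j, continuous (z j)) ->
  (forall j t, `|u j t - z j t| <= d * weight t) ->
  picard u i t - picard z i t <= d / 2 * weight t.
Proof.
move=> d0 cu cz uz; have [ts|st] := leP t s.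
  rewrite /picard !primitive_le// subrr mulr_ge0 ?divr_ge0//.
  exact: le_trans ler01 (weight_ge1 t).
pose w x := expR (2 * K * (x - s)).
have wE x : s <= x -> weight x = w x by move=> sx; rewrite /weight max_r.
pose G x := d / 2 * w x - (primitive s (field u i) x - primitive s (field z i) x).
have cG : continuous G.
  move=> x; apply: cvgB; last by apply: cvgB; apply: primitive_continuous; exact: continuous_field.
  apply: cvgM; first exact: cvg_cst.
  apply: continuous_comp; last exact: continuous_expR.
  by apply: cvgM; [exact: cvg_cst|apply: cvgB; [exact: cvg_id|exact: cvg_cst]].
have dG x : s < x -> is_derive x 1 G (d * K * w x - (field u i x - field z i x)).
  move=> sx; have h1 := primitive_is_derive (@continuous_field u i cu) sx.
  have h2 := primitive_is_derive (@continuous_field z i cz) sx.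
  have h3 : is_derive x 1 w (2 * K * w x).
    have h4 : is_derive x 1 (fun x => 2 * K * (x - s)) (2 * K).
      apply: is_derive_eq; by rewrite ?subr0 ?scaler0 ?addr0 ?scaler1 //; ring.
    by apply: is_derive_eq; rewrite mulrC.
  have h5 := is_deriveB (is_deriveM (is_derive_cst (d / 2) x 1) h3) (is_deriveB h1 h2).
  apply: (is_derive_eq h5); rewrite scaler0 addr0; congr (_ - _).
  by rewrite /GRing.scale /=; field.
(* The derivative of the weight dominates that of the difference. *)
have incr : G s <= G t.
  apply: (@ger0_derive1_ndecry _ G s _ _ _ s t (lexx s) (ltW st)).
  - by move=> x; rewrite in_itv /= andbT => sx; have h := dG x sx; exact: ex_derive.
  - move=> x; rewrite in_itv /= andbT => sx; have h := dG x sx.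
    rewrite derive1E derive_val subr_ge0.
    apply: (le_trans (ler_norm _)); rewrite (mulrC d) -mulrA -(wE x) ?(ltW sx)//.
    by apply: field_dist => j; exact: uz.
  - exact: continuous_subspaceT.
have Gs : 0 <= G s.
  by rewrite /G !primitive_le// !subr0 mulr_ge0 ?divr_ge0// expR_ge0.
rewrite (wE _ (ltW st)); have := le_trans Gs incr.
by rewrite /G /picard => h; lra.
Qed.

Let picard_contraction u z (d : R) i t : 0 <= d ->
  (forall j, continuous (u j)) -> (forall j, continuous (z j)) ->
  (forall j t, `|u j t - z j t| <= d * weight t) ->
  `|picard u i t - picard z i t| <= d / 2 * weight t.
Proof.
move=> d0 cu cz uz; rewrite ler_norml; apply/andP; split; last exact: picard_contraction_le.
rewrite lerNl opprB; apply: picard_contraction_le => // j x.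
by rewrite distrC.
Qed.

(** The limit of the Picard iterates of 0.  Consecutive iterates are
    geometrically close in the weighted distance, so the limit exists, is
    continuous by locally uniform convergence, and is fixed since the Picard map
    is a contraction. *)
Lemma linear_ode_solution : exists y : I -> R -> R,
  [/\ forall i, continuous (y i), forall i t, t <= s -> y i t = y0 i &
      forall i t, s < t -> is_derive t 1 (y i) (\sum_j b i j t * y j t)].
Proof.
pose z k := iter k picard (fun _ _ => 0).
have cz k i : continuous (z k i).
  elim: k i => [|k IH] i; first by move=> t; exact: cvg_cst.
  exact: continuous_picard.
pose A := \sum_i `|y0 i|.
have A0 : 0 <= A by apply: sumr_ge0 => i _.
have dz k i t : `|z k.+1 i t - z k i t| <= A * 2^-1 ^+ k * weight t.
  elim: k i t => [|k IH] i t.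
    rewrite /z /= subr0 expr0 mulr1 /picard.
    have -> : field (fun _ _ => 0) i = cst 0.
      by apply/funext => x; rewrite /field big1// => j _; rewrite mulr0.
    rewrite /primitive /parameterized_integral Rintegral_cst// mul0r addr0.
    apply: (@le_trans _ _ A); last by rewrite ler_peMr.
    by rewrite /A (bigD1 i)//= lerDl sumr_ge0.
  rewrite exprSr mulrA.
  apply: (@picard_contraction (z k.+1) (z k)); [|exact: cz|exact: cz|exact: IH].
  by rewrite mulr_ge0// exprn_ge0// invr_ge0.
have /choice[y yP] : forall i, exists y, forall t k,
    `|z k i t - y t| <= 2 * (A * weight t) * 2^-1 ^+ k.
  move=> i; suff /choice[y yP] : forall t, exists l, forall k,
      `|z k i t - l| <= 2 * (A * weight t) * 2^-1 ^+ k by exists y.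
  move=> t; apply: geometric_limit => k.
  by have := dz k i t; rewrite mulrAC.
have cy i : continuous (y i).
  move=> t; apply/cvgrPdist_lt => e e0.
  have [k hk] := geometric_lt (2 * (A * weight (t + 1))) (divr_gt0 e0 (ltr0n _ 3)).
  near=> x.
  have xt : x <= t + 1.
    by apply: ltW; near: x; apply: lt_nbhsl; rewrite ltrDl.
  have zx : `|z k i t - z k i x| < e / 3.
    by near: x; move: (cz k i t) => /cvgrPdist_lt /(_ _ (divr_gt0 e0 (ltr0n _ 3))).
  have bnd v : v <= t + 1 -> `|z k i v - y i v| < e / 3.
    move=> vt; apply: le_lt_trans hk; apply: (le_trans (yP i v k)).
    rewrite ler_wpM2r ?exprn_ge0 ?invr_ge0// ler_wpM2l// ler_wpM2l//.
    exact: weight_homo.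
  have b1 := bnd t; rewrite lerDl ler01 in b1; have {}b1 := b1 isT.
  have b2 := bnd x xt.
  have -> : y i t - y i x = - (z k i t - y i t) + (z k i t - z k i x) + (z k i x - y i x) by ring.
  apply: (le_lt_trans (ler_normD _ _)).
  have := ler_normD (- (z k i t - y i t)) (z k i t - z k i x); rewrite normrN => h.
  lra.
have fix_y i t : picard y i t = y i t.
  apply/eqP; rewrite -subr_eq0 -normr_le0; apply/ler_addgt0Pl => e e0; rewrite addr0.
  have [k hk] := geometric_lt (2 * A * weight t) e0.
  apply: (le_trans _ (ltW hk)).
  have h1 : `|z k.+1 i t - picard y i t| <= 2 * A * 2^-1 ^+ k / 2 * weight t.
    apply: (@picard_contraction (z k) y); [|exact: cz|exact: cy|].
      by rewrite !mulr_ge0// exprn_ge0// invr_ge0.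
    by move=> j x; apply: (le_trans (yP j x k)); rewrite !mulrA (mulrAC _ (weight x)).
  have h2 := yP i t k.+1; rewrite exprS in h2.
  have -> : picard y i t - y i t = - (z k.+1 i t - picard y i t) + (z k.+1 i t - y i t) by ring.
  apply: (le_trans (ler_normD _ _)); rewrite normrN.
  apply: (le_trans (lerD h1 h2)); rewrite le_eqVlt; apply/orP; left; apply/eqP.
  by field.
exists y; split=> // [i t ts|i t st].
  by rewrite -fix_y /picard primitive_le// addr0.
have h := primitive_is_derive (@continuous_field y i cy) st.
have -> : y i = picard y i by apply/funext => x; rewrite fix_y.
by have := is_deriveD (is_derive_cst (y0 i) t 1) h; rewrite add0r.
Unshelve. all: by end_near. Qed.

End linear_ode.

(** * Hermitian matrices in real coordinates; curves of matrices *)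

Section hermitian_coordinates.
Variable R : realType.
Local Notation C := R[i].

(** Real coordinates on the Hermitian matrices: the symmetric part of a real
    square matrix gives the real parts, the antisymmetric part the imaginary
    parts.  They turn the flow, which is only real-linear and only on Hermitian
    matrices, into a linear system with real coefficients. *)
Definition herm_of p (M : 'M[R]_p) : 'M[C]_p :=
  \matrix_(i, j) Complex ((M i j + M j i) / 2) ((M i j - M j i) / 2).

Definition coords p (X : 'M[C]_p) : 'M[R]_p :=
  \matrix_(i, j) (complex.Re (X i j) + complex.Im (X i j)).

Lemma herm_of_herm p (M : 'M[R]_p) : herm_of M \is hermsymmx.
Proof.
apply/hermP/matrixP => i j; rewrite adjmxE !mxE.
by apply: complex_ext; rewrite ?Re_conjC ?Im_conjC /=; ring.
Qed.

Lemma herm_entry p (X : 'M[C]_p) i j : X \is hermsymmx ->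
  complex.Re (X j i) = complex.Re (X i j) /\
  complex.Im (X j i) = - complex.Im (X i j).
Proof.
move=> /hermP hX; have := adjmxE X j i; rewrite hX => ->.
by rewrite Re_conjC Im_conjC.
Qed.

Lemma coordsK p (X : 'M[C]_p) : X \is hermsymmx -> herm_of (coords X) = X.
Proof.
move=> hX; apply/matrixP => i j; rewrite !mxE.
have [-> ->] := herm_entry i j hX.
by apply: complex_ext => /=; field.
Qed.

Lemma herm_ofK p (M : 'M[R]_p) : coords (herm_of M) = M.
Proof. by apply/matrixP => i j; rewrite !mxE /=; field. Qed.

Definition herm_basis p (k : 'I_p * 'I_p) : 'M[C]_p := herm_of (delta_mx k.1 k.2).

Lemma hermZ p (c : R) (X : 'M[C]_p) :
  X \is hermsymmx -> Complex c 0 *: X \is hermsymmx.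
Proof.
move=> /hermP hX; apply/hermP/matrixP => i j.
rewrite adjmxE 2!mxE rmorphM /= -{1}hX adjmxE conjCK.
by congr (_ * _); apply: complex_ext; rewrite ?Re_conjC ?Im_conjC /= ?oppr0.
Qed.

Lemma herm0 p : (0 : 'M[C]_p) \is hermsymmx.
Proof. by apply/hermP; exact: adjmx0. Qed.

Lemma herm_sum p I (r : seq I) (F : I -> 'M[C]_p) :
  (forall i, F i \is hermsymmx) -> \sum_(i <- r) F i \is hermsymmx.
Proof.
move=> hF; elim: r => [|i r IH]; first by rewrite big_nil; exact: herm0.
by rewrite big_cons; exact: hermD.
Qed.

Lemma herm_ofE p (M : 'M[R]_p) :
  herm_of M = \sum_k Complex (M k.1 k.2) 0 *: herm_basis k.
Proof.
have E (i j : 'I_p) :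
    M i j = \sum_(k : 'I_p * 'I_p) M k.1 k.2 * (delta_mx k.1 k.2 : 'M[R]_p) i j.
  by rewrite {1}[M]matrix_sum_delta pair_big summxE; apply: eq_bigr => k _; rewrite mxE.
apply/matrixP => i j; rewrite summxE.
apply: complex_ext; rewrite ?Re_sum ?Im_sum mxE /= (E i j) (E j i).
- rewrite -big_split /= mulr_suml; apply: eq_bigr => k _.
  rewrite [in RHS]mxE Re_mul /= [herm_basis _ _ _]mxE /=; ring.
- rewrite -sumrB /= mulr_suml; apply: eq_bigr => k _.
  rewrite [in RHS]mxE Im_mul /= [herm_basis _ _ _]mxE /=; ring.
Qed.

Lemma hermitian_linear_sum p q (f : 'M[C]_p -> 'M[C]_q) I (r : seq I)
    (c : I -> R) (H : I -> 'M[C]_p) :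
  hermitian_linear f -> (forall i, H i \is hermsymmx) ->
  f (\sum_(i <- r) Complex (c i) 0 *: H i) = \sum_(i <- r) Complex (c i) 0 *: f (H i).
Proof.
move=> [_ lf] hH; elim: r => [|i r IH].
  rewrite !big_nil; have := lf 1 0 0 (herm0 p) (herm0 p).
  rewrite -[Complex 1 0]/(1 : C) !scale1r addr0 => /eqP.
  by rewrite -subr_eq0 opprD addrA subrr sub0r oppr_eq0 => /eqP.
rewrite !big_cons lf ?IH//; apply: herm_sum => j; exact: hermZ.
Qed.

(** This agrees with [coords (f X)] when [X] is Hermitian, and involves [f] only
    through its values on the basis: if [f] and [X] vary with time, it inherits
    the regularity in time of these values and of [X]. *)
Definition apply_coords p q (f : 'M[C]_p -> 'M[C]_q) (X : 'M[C]_p) : 'M[R]_q :=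
  \matrix_(i, j) \sum_k coords X k.1 k.2 * coords (f (herm_basis k)) i j.

Lemma apply_coordsP p q (f : 'M[C]_p -> 'M[C]_q) X :
  hermitian_linear f -> X \is hermsymmx -> coords (f X) = apply_coords f X.
Proof.
move=> hf hX; rewrite -{1}(coordsK hX) herm_ofE hermitian_linear_sum//; last first.
  by move=> k; exact: herm_of_herm.
apply/matrixP => i j; rewrite !mxE summxE Re_sum Im_sum -big_split /=.
by apply: eq_bigr => k _; rewrite !mxE Re_mul Im_mul /=; ring.
Qed.

Lemma herm_of_apply_coords p q (f : 'M[C]_p -> 'M[C]_q) X :
  hermitian_linear f -> X \is hermsymmx -> herm_of (apply_coords f X) = f X.
Proof.
by move=> hf hX; rewrite -apply_coordsP// coordsK//; apply hf.1.
Qed.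

Lemma hermitian_linear_comp p q r (f : 'M[C]_q -> 'M[C]_r) (M : 'M[C]_(q, p)) :
  hermitian_linear f -> hermitian_linear (fun Y => f (M *m Y *m M ^t*)).
Proof.
move=> [hf lf]; split=> [X hX|c X Y hX hY].
  by apply: hf; exact: herm_congr.
by rewrite mulmxDr mulmxDl -scalemxAr -scalemxAl lf//; exact: herm_congr.
Qed.

End hermitian_coordinates.

Section matrix_functions.
Variable R : realType.
Local Notation C := R[i].
Implicit Types (a b t : R).

Lemma pw_mulmx a b p q r (A : R -> 'M[C]_(p, q)) (B : R -> 'M[C]_(q, r)) :
  parts (pw_continuous a b) A -> parts (pw_continuous a b) B ->
  parts (pw_continuous a b) (fun t => A t *m B t).
Proof.
move=> pA pB i j; split.
  under eq_fun do rewrite mxE Re_sum.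
  apply: pw_sum => k; under eq_fun do rewrite Re_mul.
  apply: pwD; first exact: pwM (pA i k).1 (pB k j).1.
  by apply: pwN; exact: pwM (pA i k).2 (pB k j).2.
under eq_fun do rewrite mxE Im_sum.
apply: pw_sum => k; under eq_fun do rewrite Im_mul.
by apply: pwD; apply: pwM; [case: (pA i k)|case: (pB k j)|case: (pA i k)|case: (pB k j)].
Qed.

Lemma pw_adjmx a b p q (A : R -> 'M[C]_(p, q)) :
  parts (pw_continuous a b) A -> parts (pw_continuous a b) (fun t => (A t) ^t*).
Proof.
move=> pA i j; split.
  by under eq_fun do rewrite adjmxE Re_conjC; case: (pA j i).
by under eq_fun do rewrite adjmxE Im_conjC; apply: pwN; case: (pA j i).
Qed.

Lemma pw_cstmx a b p q (A : 'M[C]_(p, q)) : parts (pw_continuous a b) (fun _ => A).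
Proof. by move=> i j; split; exact: pw_cst. Qed.

Lemma pw_col_mx a b p q r (A : R -> 'M[C]_(p, r)) (B : R -> 'M[C]_(q, r)) :
  parts (pw_continuous a b) A -> parts (pw_continuous a b) B ->
  parts (pw_continuous a b) (fun t => col_mx (A t) (B t)).
Proof.
move=> pA pB i j; case: (split_ordP i) => k ->; split.
- by under eq_fun do rewrite col_mxEu; case: (pA k j).
- by under eq_fun do rewrite col_mxEu; case: (pA k j).
- by under eq_fun do rewrite col_mxEd; case: (pB k j).
- by under eq_fun do rewrite col_mxEd; case: (pB k j).
Qed.

Lemma pw_partsS a b c d p q (A : R -> 'M[C]_(p, q)) : a <= c -> d <= b ->
  parts (pw_continuous a b) A -> parts (pw_continuous c d) A.
Proof. by move=> ac db pA i j; split; apply: (pw_sub ac db); case: (pA i j). Qed.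

Lemma pw_ip a b p (A B : R -> 'M[C]_p) :
  parts (pw_continuous a b) A -> parts (pw_continuous a b) B ->
  pw_continuous a b (fun t => ip (A t) (B t)).
Proof.
move=> pA pB; under eq_fun do rewrite ipE.
apply: pw_sum => i; apply: pw_sum => j.
by apply: pwD; apply: pwM; [case: (pA i j)|case: (pB i j)|case: (pA i j)|case: (pB i j)].
Qed.

Lemma pw_coords a b p (X : R -> 'M[C]_p) i j : parts (pw_continuous a b) X ->
  pw_continuous a b (fun t => coords (X t) i j).
Proof.
move=> pX; under eq_fun do rewrite mxE.
by apply: pwD; case: (pX i j).
Qed.

Lemma pw_herm_of a b p (M : R -> 'M[R]_p) :
  (forall i j, pw_continuous a b (fun t => M t i j)) ->
  parts (pw_continuous a b) (fun t => herm_of (M t)).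
Proof.
move=> pM i j; split; under eq_fun do rewrite mxE /=; apply: pwM (pw_cst _ _ _).
  exact: pwD.
by apply: pwD => //; exact: pwN.
Qed.

Lemma mcvg_near_eq p q (F : set_system R) (FF : Filter F)
    (A B : R -> 'M[C]_(p, q)) L :
  (\forall x \near F, A x = B x) -> mcvg A F L -> mcvg B F L.
Proof.
move=> AB AL i j; have [h1 h2] := AL i j; split.
  by apply: cvg_near_eq h1; apply: filterS AB => x ->.
by apply: cvg_near_eq h2; apply: filterS AB => x ->.
Qed.

Lemma mlimE p q (F : set_system R) (FF : ProperFilter F) (A : R -> 'M[C]_(p, q)) L :
  mcvg A F L -> mlim A F = L.
Proof.
move=> AL; apply/matrixP => i j; have [h1 h2] := AL i j; rewrite mxE.
by apply: complex_ext => /=; apply: cvg_lim.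
Qed.

Lemma mcvg_mlim p q (F : set_system R) (FF : ProperFilter F) (A : R -> 'M[C]_(p, q)) :
  parts (fun f => cvg (f x @[x --> F])) A -> mcvg A F (mlim A F).
Proof. by move=> cA i j; have [h1 h2] := cA i j; rewrite mxE. Qed.

Lemma pw_mcvg_right a b p q (A : R -> 'M[C]_(p, q)) t :
  parts (pw_continuous a b) A -> a <= t < b -> mcvg A t^'+ (mlim A t^'+).
Proof.
move=> pA tab; apply: mcvg_mlim => i j.
by have [[D [_ h1 _]] [E [_ h2 _]]] := pA i j; split; [exact: h1|exact: h2].
Qed.

Lemma pw_mcvg_left a b p q (A : R -> 'M[C]_(p, q)) t :
  parts (pw_continuous a b) A -> a < t <= b -> mcvg A t^'- (mlim A t^'-).
Proof.
move=> pA tab; apply: mcvg_mlim => i j.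
by have [[D [_ _ h1]] [E [_ _ h2]]] := pA i j; split; [exact: h1|exact: h2].
Qed.

Lemma mcvg_ip p (F : set_system R) (FF : Filter F) (A B : R -> 'M[C]_p) LA LB :
  mcvg A F LA -> mcvg B F LB ->
  ip (A x) (B x) @[x --> F] --> ip LA LB.
Proof.
move=> cA cB; rewrite ipE; under eq_fun do rewrite ipE.
apply: cvg_sumr => i; apply: cvg_sumr => j.
have [a1 a2] := cA i j; have [b1 b2] := cB i j.
by apply: cvgD; exact: cvgM.
Qed.

Lemma mderive_near_eq p q (A B : R -> 'M[C]_(p, q)) t :
  (\forall x \near t, A x = B x) -> mderivable A t ->
  mderivable B t /\ mderive B t = mderive A t.
Proof.
move=> AB dA; split.
  move=> i j; have [h1 h2] := dA i j; split.
    by apply: near_eq_derivable h1; apply: filterS AB => x ->.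
  by apply: near_eq_derivable h2; apply: filterS AB => x ->.
apply/matrixP => i j; rewrite !mxE !derive1E.
by apply: complex_ext => /=; apply: near_eq_derive; apply: filterS AB => x ->.
Qed.

Lemma is_derive_ip p (A B : R -> 'M[C]_p) t : mderivable A t -> mderivable B t ->
  is_derive t 1 (fun s => ip (A s) (B s))
    (ip (mderive A t) (B t) + ip (A t) (mderive B t)).
Proof.
move=> dA dB; under eq_fun do rewrite ipE.
rewrite !ipE -big_split /=; apply: is_derive_sumr => i.
rewrite -big_split /=; apply: is_derive_sumr => j.
have [/derivableP a1 /derivableP a2] := dA i j.
have [/derivableP b1 /derivableP b2] := dB i j.
apply: (is_derive_eq (is_deriveD (is_deriveM a1 b1) (is_deriveM a2 b2))).
by rewrite !mxE /= !derive1E /GRing.scale /=; ring.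
Qed.

Lemma mderive_herm p (A : R -> 'M[C]_p) t : (\forall x \near t, A x \is hermsymmx) ->
  mderivable A t -> mderive A t \is hermsymmx.
Proof.
move=> hA dA; apply/hermP/matrixP => i j; rewrite adjmxE !mxE !derive1E.
apply: complex_ext; rewrite ?Re_conjC ?Im_conjC /=.
  apply: near_eq_derive; apply: filterS hA => x hx.
  by have [] := herm_entry i j hx.
rewrite -deriveN; last by case: (dA j i).
apply: near_eq_derive; apply: filterS hA => x hx.
by rewrite /= fctE; have [_ ->] := herm_entry i j hx; rewrite opprK.
Qed.

Lemma mcvg_herm p (F : set_system R) (FF : ProperFilter F) (A : R -> 'M[C]_p) L :
  (\forall x \near F, A x \is hermsymmx) -> mcvg A F L -> L \is hermsymmx.
Proof.
move=> hA cA; apply/hermP/matrixP => i j; rewrite adjmxE.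
have [h1 h2] := cA i j; have [h3 h4] := cA j i.
apply: complex_ext; rewrite ?Re_conjC ?Im_conjC.
  have h : complex.Re (A x j i) @[x --> F] --> complex.Re (L i j).
    by apply: cvg_near_eq h1; apply: filterS hA => x hx; have [] := herm_entry i j hx.
  exact: (cvg_unique _ h3 h).
have h : - complex.Im (A x j i) @[x --> F] --> complex.Im (L i j).
  apply: cvg_near_eq h2; apply: filterS hA => x hx.
  by have [_ ->] := herm_entry i j hx; rewrite opprK.
exact: (cvg_unique _ (cvgN h4) h).
Qed.

End matrix_functions.

(** * Trajectories under linear feedback *)

Section herm_of_curves.
Variable R : realType.

Lemma herm_of_mcvg p (F : set_system R) (FF : Filter F) (M : R -> 'M[R]_p)
    (L : 'M[R]_p) :
  (forall i j, M x i j @[x --> F] --> L i j) ->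
  mcvg (fun x => herm_of (M x)) F (herm_of L).
Proof.
move=> cM i j; split; rewrite mxE /=; under eq_fun do rewrite mxE /=;
  apply: cvgM; try exact: cvg_cst.
- by apply: cvgD.
- by apply: cvgB.
Qed.

Lemma herm_of_mderive p (M : R -> 'M[R]_p) (M' : 'M[R]_p) (t : R) :
  (forall i j, is_derive t 1 (fun x => M x i j) (M' i j)) ->
  mderivable (fun x => herm_of (M x)) t /\
  mderive (fun x => herm_of (M x)) t = herm_of M'.
Proof.
move=> dM.
have dR i j : is_derive t 1 (fun x => complex.Re (herm_of (M x) i j))
    (complex.Re (herm_of M' i j)).
  rewrite mxE /=; under eq_fun do rewrite mxE /=.
  apply: (is_derive_eq (is_deriveM (is_deriveD (dM i j) (dM j i)) (is_derive_cst (2^-1 : R) t 1))).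
  by rewrite scaler0 add0r /GRing.scale /= mulrC.
have dI i j : is_derive t 1 (fun x => complex.Im (herm_of (M x) i j))
    (complex.Im (herm_of M' i j)).
  rewrite mxE /=; under eq_fun do rewrite mxE /=.
  apply: (is_derive_eq (is_deriveM (is_deriveB (dM i j) (dM j i)) (is_derive_cst (2^-1 : R) t 1))).
  by rewrite scaler0 add0r /GRing.scale /= mulrC.
split=> [i j|]; first by split; exact: ex_derive.
apply/matrixP => i j; rewrite mxE !derive1E.
have h1 := dR i j; have h2 := dI i j.
by apply: complex_ext => /=; rewrite derive_val.
Qed.

Lemma pw_common (I : finType) a b (F : I -> R -> R) :
  (forall i, pw_continuous a b (F i)) ->
  exists D : seq R, forall i,
    [/\ forall t, a < t < b -> t \notin D -> {for t, continuous (F i)},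
        forall t, a <= t < b -> cvg (F i x @[x --> t^'+])
      & forall t, a < t <= b -> cvg (F i x @[x --> t^'-])].
Proof.
move=> /choice[D DP]; exists (flatten [seq D i | i <- enum I]) => i.
have [h1 h2 h3] := DP i; split=> // t tab tD; apply: h1 => //.
apply: contra tD => tDi; apply/flattenP; exists (D i) => //.
by apply: map_f; rewrite mem_enum.
Qed.

End herm_of_curves.

Section trajectories.
Variables (R : realType) (n mu mw : nat) (g : game R n mu mw).
Local Notation C := R[i].
Local Notation mat := 'M[C]_(n + (mu + mw)).
Local Notation a := (t0 g).
Local Notation b := (t0 g + horizon g).
Hypothesis Hg : standing g.

Lemma pw_flow (X : R -> mat) i j : parts (pw_continuous a b) X ->
  pw_continuous a b (fun t => apply_coords (flow g t) (X t) i j).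
Proof.
move=> pX; under eq_fun do rewrite mxE.
have ab : a < b by rewrite ltrDl; exact: horizon_gt0 Hg.
apply: pw_sum => k; apply: pwM; first exact: pw_coords.
have := flow_continuous Hg (herm_of_herm (delta_mx k.1 k.2)) => /(_ i j)[h1 h2].
under eq_fun do rewrite mxE.
by apply: pwD; exact: pw_within.
Qed.

Definition closed_loop (K : R -> 'M[C]_(mu + mw, n)) t (Y : 'M[C]_n) : 'M[C]_n :=
  flow g t (col_mx 1%:M (K t) *m Y *m (col_mx 1%:M (K t)) ^t*).

Lemma closed_loop_linear K t : hermitian_linear (closed_loop K t).
Proof. by apply: hermitian_linear_comp; exact: flow_linear Hg t. Qed.

(** Off a finite set of instants the closed loop is a linear differential
    equation with continuous coefficients; the cone is preserved because the
    flow leaves it invariant. *)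
Lemma closed_loop_arc K : parts (pw_continuous a b) K ->
  exists D : seq R, forall c d Y0, a <= c -> c < d -> d <= b ->
    (forall t, c < t < d -> t \notin D) -> psd Y0 ->
  exists Y : R -> 'M[C]_n,
    [/\ forall t, c <= t <= d -> psd (Y t), Y c = Y0, forall t, mcvg Y (nbhs t) (Y t) &
        forall t, c < t < d ->
          mderivable Y t /\ mderive Y t = closed_loop K t (Y t)].
Proof.
move=> pK; pose L t := col_mx (1%:M : 'M[C]_n) (K t).
have pL : parts (pw_continuous a b) L by apply: pw_col_mx => //; exact: pw_cstmx.
pose I := ('I_n * 'I_n)%type.
pose B0 (kl : I * I) t := apply_coords (flow g t)
  (L t *m herm_basis R kl.2 *m (L t) ^t*) kl.1.1 kl.1.2.
have [|D DP] := @pw_common _ (I * I)%type a b B0.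
  move=> kl; apply: pw_flow; apply: pw_mulmx; last exact: pw_adjmx.
  by apply: pw_mulmx => //; exact: pw_cstmx.
exists D => c d Y0 ac cd db noD pY0.
have /choice[B1 B1P] : forall kl : I * I, exists BM : (R -> R) * R,
    [/\ continuous BM.1, forall t, c < t < d -> BM.1 t = B0 kl t &
        forall t, `|BM.1 t| <= BM.2].
  move=> kl; have [h1 h2 h3] := DP kl.
  have [G [cG GE _ _ [M GM]]] := pw_extension h1 h2 h3 ac cd db noD.
  by exists (G, M).
pose M := \sum_kl `|(B1 kl).2|.
have [||y [cy y0 dy]] := @linear_ode_solution R I (fun k l => (B1 (k, l)).1) M c
    (fun k => coords Y0 k.1 k.2).
- by move=> k l; have [] := B1P (k, l).
- move=> k l t; have [_ _ h] := B1P (k, l).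
  apply: (le_trans (h t)); apply: (le_trans (ler_norm _)).
  by rewrite /M (bigD1 (k, l))//= lerDl sumr_ge0.
pose m t : 'M[R]_n := \matrix_(i, j) y (i, j) t.
pose Y t := herm_of (m t).
have cY t : mcvg Y (nbhs t) (Y t).
  apply: herm_of_mcvg => i j; rewrite mxE; under eq_fun do rewrite mxE.
  exact: cy.
have Yc : Y c = Y0.
  rewrite -[RHS](coordsK (proj1 pY0)); congr herm_of.
  by apply/matrixP => i j; rewrite mxE y0.
have dY t : c < t < d -> mderivable Y t /\ mderive Y t = closed_loop K t (Y t).
  move=> ctd; have hY : Y t \is hermsymmx by exact: herm_of_herm.
  have hC := closed_loop_linear K t.
  rewrite -(coordsK (proj1 hC _ hY)); apply: herm_of_mderive => i j.
  under eq_fun do rewrite mxE.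
  have ct : c < t by case/andP: ctd.
  apply: (is_derive_eq (dy (i, j) t ct)).
  rewrite (apply_coordsP hC hY) mxE; apply: eq_bigr => l _.
  rewrite /Y herm_ofK mxE -surjective_pairing mulrC; congr (_ * _).
  have [_ -> // _] := B1P ((i, j), l).
  rewrite /B0 /= -(apply_coordsP (flow_linear Hg t))//.
  exact: herm_congr (herm_of_herm _).
exists Y; split; [|exact: Yc|exact: cY|exact: dY] => t ctd.
apply: (@flow_cone _ _ _ _ _ Hg c d K (fun _ => 0) Y ac cd db).
- exact: pw_partsS ac db pK.
- exact: pw_cstmx.
- move=> _; have -> : (0 : 'M[C]_(mu + mw)) = (0 : 'M[C]_(mu + mw)) *m 0 ^t*.
    by rewrite mul0mx.
  exact: psd_gram.
- by move=> x; exact: herm_of_herm.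
- split=> x _ _ i j; have [h1 h2] := cY x i j; split.
  + exact: cvg_at_right_filter.
  + exact: cvg_at_right_filter.
  + exact: cvg_at_left_filter.
  + exact: cvg_at_left_filter.
- exists [::] => x cxd _; have [h1 h2] := dY x cxd; split=> //.
  by rewrite block_mx_const addr0.
- by rewrite Yc.
- exact: ctd.
Qed.

Section feedback.
Variables (Ku : R -> 'M[C]_(mu, n)) (Kw : R -> 'M[C]_(mw, n)).
Hypotheses (gKu : gains g Ku) (gKw : gains g Kw).
Local Notation K := (fun t => col_mx (Ku t) (Kw t)).

(** The right limit that a state equal to [Y] just before [t] must have; it makes
    the jumps and the continuity elsewhere a single condition. *)
Definition after (t : R) (Y : 'M[C]_n) : 'M[C]_n :=
  if [pick k : 'I_(njumps g) | tj g k == t] is Some k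
  then jump g k (lift_gains (Ku t) (Kw t) Y) else Y.

Lemma tj_inj : injective (tj g).
Proof.
by move=> k l e; case: (ltngtP k l) => // /(tj_increasing Hg); rewrite e ltxx.
Qed.

Lemma after_jump k Y : (k < njumps g)%N ->
  after (tj g k) Y = jump g k (lift_gains (Ku (tj g k)) (Kw (tj g k)) Y).
Proof.
move=> kN; rewrite /after; case: pickP => [l /eqP /tj_inj -> //|].
by move=> /(_ (Ordinal kN)); rewrite eqxx.
Qed.

Lemma after_flow t Y : ~ jump_time g t -> after t Y = Y.
Proof.
move=> nj; rewrite /after; case: pickP => // k /eqP e.
by exfalso; apply: nj; exists k.
Qed.

Lemma psd_after t Y : psd Y -> psd (after t Y).
Proof.
move=> pY; rewrite /after; case: pickP => [k _|_]; last exact: pY.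
by apply: (jump_cone Hg); exact: psd_congr.
Qed.

(** Solutions are left-continuous: at a jump the value is the state before it,
    so two arcs are concatenated by keeping the left one at the common point. *)
Definition arc c d Y0 (Y : R -> 'M[C]_n) : Prop :=
  [/\ forall t, c <= t <= d -> psd (Y t), Y c = Y0 /\ mcvg Y c^'+ Y0,
      forall t, c < t <= d -> mcvg Y t^'- (Y t),
      forall t, c < t < d -> mcvg Y t^'+ (after t (Y t)) &
      exists D : seq R, forall t, c < t < d -> t \notin D ->
        mderivable Y t /\ mderive Y t = closed_loop K t (Y t)].

Lemma arc_glue c m d Y0 Y1 Y2 : c < m -> m < d ->
  arc c m Y0 Y1 -> arc m d (after m (Y1 m)) Y2 ->
  arc c d Y0 (fun t => if t <= m then Y1 t else Y2 t).
Proof.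
move=> cm md [p1 [i1 r1] l1 j1 [D1 d1]] [p2 [i2 r2] l2 j2 [D2 d2]].
pose Y t := if t <= m then Y1 t else Y2 t.
have Yl t : t < m -> \forall x \near t, Y1 x = Y x.
  move=> tm; near=> x; rewrite /Y ifT//; apply: ltW; near: x; exact: lt_nbhsl.
have Yr t : m < t -> \forall x \near t, Y2 x = Y x.
  move=> mt; near=> x; rewrite /Y leNgt ifF//; apply/negbTE/negPn; near: x.
  exact: lt_nbhsr.
have atl t (P : R -> Prop) : (\forall x \near t, P x) -> \forall x \near t^'-, P x.
  by move=> h; near=> x; near: x; apply: cvg_at_left_filter h; exact: cvg_id.
have atr t (P : R -> Prop) : (\forall x \near t, P x) -> \forall x \near t^'+, P x.
  by move=> h; near=> x; near: x; apply: cvg_at_right_filter h; exact: cvg_id.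
rewrite -/Y; split.
- move=> t /andP[ct td]; rewrite /Y; case: ifP => tm; first by apply: p1; rewrite ct.
  by apply: p2; rewrite td andbT ltW// ltNge tm.
- split; first by rewrite /Y ifT// ltW.
  by apply: mcvg_near_eq r1; apply: atr; exact: Yl.
- move=> t /andP[ct td]; rewrite /Y; have [tm|mt] := leP t m.
    have h : mcvg Y1 t^'- (Y1 t) by apply: l1; rewrite ct.
    apply: mcvg_near_eq h; near=> x; rewrite ifT//.
    by apply: (le_trans _ tm); apply: ltW; near: x; exact: nbhs_left_lt.
  have h : mcvg Y2 t^'- (Y2 t) by apply: l2; rewrite mt.
  by apply: mcvg_near_eq h; apply: atl; exact: Yr.
- move=> t /andP[ct td]; have [tm|mt|tm] := ltgtP t m.
  + have -> : Y t = Y1 t by rewrite /Y ltW.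
    have h : mcvg Y1 t^'+ (after t (Y1 t)) by apply: j1; rewrite ct.
    by apply: mcvg_near_eq h; apply: atr; exact: Yl.
  + have -> : Y t = Y2 t by rewrite /Y leNgt mt.
    have h : mcvg Y2 t^'+ (after t (Y2 t)) by apply: j2; rewrite mt.
    by apply: mcvg_near_eq h; apply: atr; exact: Yr.
  + rewrite tm; have -> : Y m = Y1 m by rewrite /Y lexx.
    apply: mcvg_near_eq r2; near=> x; rewrite /Y leNgt ifF//; apply/negbTE/negPn.
    by near: x; exact: nbhs_right_gt.
- exists (m :: D1 ++ D2) => t /andP[ct td].
  rewrite inE mem_cat !negb_or => /and3P[tm tD1 tD2].
  have [lt_tm|lt_mt|tm'] := ltgtP t m; last by rewrite tm' eqxx in tm.
  + have -> : Y t = Y1 t by rewrite /Y ltW.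
    have [|h1 h2] := d1 t _ tD1; first by rewrite ct.
    by have [h3 h4] := mderive_near_eq (Yl _ lt_tm) h1; rewrite h4.
  + have -> : Y t = Y2 t by rewrite /Y leNgt lt_mt.
    have [|h1 h2] := d2 t _ tD2; first by rewrite lt_mt.
    by have [h3 h4] := mderive_near_eq (Yr _ lt_mt) h1; rewrite h4.
Unshelve. all: by end_near. Qed.

Lemma arc_exists Y0 : psd Y0 -> exists Y, arc a b Y0 Y.
Proof.
move=> pY0; have pK : parts (pw_continuous a b) K by exact: pw_col_mx.
have [D DP] := closed_loop_arc pK.
have ab : a < b by rewrite ltrDl; exact: horizon_gt0 Hg.
move: Y0 pY0; apply: (@itv_glue R a b (D ++ [seq tj g k | k <- iota 0 (njumps g)])
  (fun c d => forall Y0, psd Y0 -> exists Y, arc c d Y0 Y)); rewrite ?lexx//.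
  move=> c m d _ cm md _ h1 h2 Y0 pY0; have [Y1 A1] := h1 _ pY0.
  have pm : psd (Y1 m) by case: A1 => p1 _ _ _ _; apply: p1; rewrite lexx ltW.
  have [Y2 A2] := h2 _ (psd_after m pm).
  by exists (fun t => if t <= m then Y1 t else Y2 t); exact: arc_glue.
move=> c d ac cd db noD Y0 pY0.
have noD1 t : c < t < d -> t \notin D.
  by move=> /noD; rewrite mem_cat negb_or => /andP[].
have noJ t : c < t < d -> ~ jump_time g t.
  move=> /noD; rewrite mem_cat negb_or => /andP[_ /negP h] [k kN e]; apply: h.
  by rewrite e; apply: map_f; rewrite mem_iota /= add0n.
have [Y [pY Yc cY dY]] := DP c d Y0 ac cd db noD1 pY0.
have cYr t : mcvg Y t^'+ (Y t).
  by move=> i j; have [h1 h2] := cY t i j; split; exact: cvg_at_right_filter.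
have cYl t : mcvg Y t^'- (Y t).
  by move=> i j; have [h1 h2] := cY t i j; split; exact: cvg_at_left_filter.
exists Y; split; [exact: pY|by split; rewrite // -Yc|by move=> t _; exact: cYl| |].
  by move=> t /noJ nj; rewrite after_flow.
by exists [::] => t ctd _; exact: dY.
Qed.

Lemma state_lift (Ku0 : 'M[C]_(mu, n)) (Kw0 : 'M[C]_(mw, n)) Y :
  state (lift_gains Ku0 Kw0 Y) = Y.
Proof.
rewrite /state /lift_gains /Emx !mulmxA mul_row_col mul1mx mul0mx addr0 mul1mx.
by rewrite -mulmxA -adjmxM mul_row_col mul1mx mul0mx addr0 adjmx1 mulmx1.
Qed.

Lemma not_jump_time0 : ~ jump_time g a.
Proof. by move=> [k kN e]; have := tj_window Hg k; rewrite kN -e ltxx. Qed.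

Lemma not_jump_time1 : ~ jump_time g b.
Proof. by move=> [k kN e]; have := tj_window Hg k; rewrite kN -e ltxx andbF. Qed.

Lemma feedback_trajectory X10 : psd X10 -> exists X, trajectory g X10 X /\
  forall t, X t = lift_gains (Ku t) (Kw t) (state (X t)).
Proof.
move=> pX10; have [Y [pY [Ya ra] lY rY [D dY]]] := arc_exists pX10.
have ab : a < b by rewrite ltrDl; exact: horizon_gt0 Hg.
exists (fun t => lift_gains (Ku t) (Kw t) (Y t)); split; last first.
  by move=> t; rewrite state_lift.
have stY : (fun t => state (lift_gains (Ku t) (Kw t) (Y t))) = Y.
  by apply/funext => t; rewrite state_lift.
have ptY : parts (pw_continuous a b) Y.
  have rcv t i j : a <= t < b -> cvg (complex.Re (Y x i j) @[x --> t^'+]) /\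
      cvg (complex.Im (Y x i j) @[x --> t^'+]).
    case/andP; rewrite le_eqVlt => /predU1P[<- _|at_ tb].
      by have [h1 h2] := ra i j; split; apply/cvg_ex; [eexists; exact: h1|eexists; exact: h2].
    have /rY/(_ i j)[h1 h2] : a < t < b by rewrite at_.
    by split; apply/cvg_ex; [eexists; exact: h1|eexists; exact: h2].
  have lcv t i j : a < t <= b -> cvg (complex.Re (Y x i j) @[x --> t^'-]) /\
      cvg (complex.Im (Y x i j) @[x --> t^'-]).
    by move=> /lY/(_ i j)[h1 h2]; split; apply/cvg_ex; [eexists; exact: h1|eexists; exact: h2].
  have ccv t i j : a < t < b -> t \notin [seq tj g k | k <- iota 0 (njumps g)] ->
      {for t, continuous (fun x => complex.Re (Y x i j))} /\
      {for t, continuous (fun x => complex.Im (Y x i j))}.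
    move=> tab tJ; have nj : ~ jump_time g t.
      move=> [k kN e]; move/negP: tJ; apply.
      by rewrite e; apply: map_f; rewrite mem_iota /= add0n.
    have /lY/(_ i j)[l1 l2] : a < t <= b by case/andP: tab => -> /ltW ->.
    have := rY t tab; rewrite after_flow// => /(_ i j)[r1 r2].
    by split; apply/left_right_continuousP.
  move=> i j; split; exists [seq tj g k | k <- iota 0 (njumps g)]; split=> t h.
  - by move=> /(ccv t i j h)[].
  - by case: (rcv t i j h).
  - by case: (lcv t i j h).
  - by move=> /(ccv t i j h)[].
  - by case: (rcv t i j h).
  - by case: (lcv t i j h).
split.
- split=> [t /pY h|]; first exact: psd_congr.
  have pL : parts (pw_continuous a b) (fun t => col_mx (1%:M : 'M[C]_n) (col_mx (Ku t) (Kw t))).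
    by apply: pw_col_mx; [exact: pw_cstmx|exact: pw_col_mx].
  by apply: pw_mulmx; [exact: pw_mulmx|exact: pw_adjmx].
- rewrite /= stY; split.
    split=> t; last by move=> /lY.
    case/andP; rewrite le_eqVlt => /predU1P[<- _ _|at_ tb nj]; first by rewrite Ya.
    by rewrite -[X in mcvg _ _ X](after_flow (Y t) nj); apply: rY; rewrite at_.
  move=> k kN; rewrite state_lift; apply: lY.
  by have := tj_window Hg k; rewrite kN => /andP[-> /ltW ->].
- exists D; rewrite stY; exact: dY.
- move=> k kN; rewrite stY -after_jump//; apply: rY.
  by rewrite (tj_window Hg).
- by rewrite state_lift.
Qed.

End feedback.
End trajectories.

(** * Expansion of the cost along a trajectory *)

Section almost_everywhere.
Variable R : realType.
Local Notation mes := (@lebesgue_measure R).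

Lemma aeS2 (P Q S : R -> Prop) : {ae mes, forall t, P t} -> {ae mes, forall t, Q t} ->
  (forall t, P t -> Q t -> S t) -> {ae mes, forall t, S t}.
Proof.
have FF : Filter (nbhs (almost_everywhere mes)) := ae_filter_ringOfSetsType mes.
by move=> hP hQ PQS; apply: filterS2 hP hQ.
Qed.

Lemma aeS (P S : R -> Prop) : {ae mes, forall t, P t} ->
  (forall t, P t -> S t) -> {ae mes, forall t, S t}.
Proof. by move=> hP PS; apply: (aeS2 hP hP) => t /PS. Qed.

Lemma ae_notin (D : seq R) : {ae mes, forall t, t \notin D}.
Proof.
elim: D => [|x D IH]; first exact: aeW.
have hx : {ae mes, forall t, t != x}.
  exists [set x]; split; [exact: measurable_set1|exact: lebesgue_measure_set1|].
  by move=> t /= /negP; rewrite negbK => /eqP.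
apply: (aeS2 hx IH) => t tx tD.
by rewrite inE negb_or tx.
Qed.

Lemma integrable_eqE (D : set (measurableTypeR R)) (F : R -> \bar R) (f : R -> R) : measurable D ->
  (forall t, F t = (f t)%:E) -> mes.-integrable D F ->
  mes.-integrable D (EFin \o f).
Proof. by move=> mD e; have -> : F = EFin \o f by apply/funext. Qed.

Lemma Rintegral_ge0_ae (D : set (measurableTypeR R)) (f : R -> R) :
  measurable D -> mes.-integrable D (EFin \o f) ->
  {ae mes, forall t, D t -> 0 <= f t} -> 0 <= \int[mes]_(t in D) f t.
Proof.
move=> mD fi f0; have mf := measurable_int _ fi.
rewrite /Rintegral (@ae_eq_integral _ _ _ mes D (abse \o (EFin \o f)))//.
- by apply: fine_ge0; apply: integral_ge0 => t _; exact: abse_ge0.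
- exact: measurableT_comp.
- by apply: (aeS f0) => t h Dt /=; rewrite ger0_norm// h.
Qed.

Lemma Rintegral_le0_ae (D : set (measurableTypeR R)) (f : R -> R) :
  measurable D -> mes.-integrable D (EFin \o f) ->
  {ae mes, forall t, D t -> f t <= 0} -> \int[mes]_(t in D) f t <= 0.
Proof.
move=> mD fi f0; rewrite -oppr_ge0 -mulN1r -RintegralZl//.
apply: Rintegral_ge0_ae => //.
  apply: (integrable_eqE mD _ (integrableZl mD (-1) fi)) => t.
  by rewrite /= EFinM.
by apply: (aeS f0) => t h Dt; rewrite mulN1r oppr_ge0 h.
Qed.

Lemma ip_integrable a b p (Z X : R -> 'M[R[i]]_p) : a < b ->
  parts (fun f => mes.-integrable `[a, b] (EFin \o f)) Z ->
  parts (pw_continuous a b) X ->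
  mes.-integrable `[a, b] (EFin \o (fun t => ip (Z t) (X t))).
Proof.
move=> ab iZ pX.
have sum_int I (r : seq I) (F : I -> R -> R) :
    (forall i, mes.-integrable `[a, b] (EFin \o F i)) ->
    mes.-integrable `[a, b] (EFin \o (fun t => \sum_(i <- r) F i t)).
  move=> iF; elim: r => [|i r IH].
    have -> : (fun t => \sum_(i <- [::]) F i t) = cst 0.
      by apply/funext => t; rewrite big_nil.
    exact: integrable0.
  have -> : (fun t => \sum_(j <- i :: r) F j t) =
      (fun t => F i t + \sum_(j <- r) F j t).
    by apply/funext => t; rewrite big_cons.
  exact: (integrable_eqE _ _ (integrableD _ (iF i) IH)).
have mul_int f h : mes.-integrable `[a, b] (EFin \o f) -> pw_continuous a b h ->
    mes.-integrable `[a, b] (EFin \o (fun t => f t * h t)).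
  move=> fi ph.
  suff i : mes.-integrable `[a, b] ((EFin \o f) \* (EFin \o h))%E.
    exact: integrable_eqE i.
  apply: integrableMl => //; first exact: pw_measurable.
  have [M hM] := pw_bounded ab ph; exists M; split; first exact: num_real.
  by move=> x Mx t; rewrite /= in_itv /= => /hM /le_trans; apply; exact: ltW.
have -> : (fun t => ip (Z t) (X t)) = (fun t => \sum_i \sum_j
   (complex.Re (Z t i j) * complex.Re (X t i j) +
    complex.Im (Z t i j) * complex.Im (X t i j))).
  by apply/funext => t; rewrite ipE.
apply: (sum_int) => i; apply: sum_int => j.
have [z1 z2] := iZ i j; have [x1 x2] := pX i j.
exact: (integrable_eqE _ _ (integrableD _ (mul_int _ _ z1 x1) (mul_int _ _ z2 x2))).
Qed.

End almost_everywhere.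

Section verification.
Variables (R : realType) (n mu mw : nat) (g : game R n mu mw).
Local Notation C := R[i].
Local Notation mat := 'M[C]_(n + (mu + mw)).
Local Notation a := (t0 g).
Local Notation b := (t0 g + horizon g).
Local Notation mes := (@lebesgue_measure R).
Hypothesis Hg : standing g.
Variable P : R -> 'M[C]_n.
Hypothesis HP : gre_solution g P.

Let ab : a < b.
Proof. by rewrite ltrDl; exact: horizon_gt0 Hg. Qed.

Let pwP : parts (pw_continuous a b) P.
Proof. by case: HP => _ [cP _] _ _ i j; have [[? _ _] [? _ _]] := cP i j. Qed.

Let hermP_in t : a <= t <= b -> P t \is hermsymmx.
Proof. by case: HP => [[h _] _ _ _] tab; exact: (proj1 (h t tab)). Qed.

Let tj_in k : (k < njumps g)%N -> a < tj g k < b.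
Proof. by move=> kN; rewrite (tj_window Hg). Qed.

Lemma gre_mderivable : exists D : seq R, forall t, a < t < b -> t \notin D ->
  mderivable P t.
Proof.
have cP : parts (pw_C1 a b) P by case: HP => _ [].
have /choice[D1 h1] : forall ij : 'I_n * 'I_n, exists D : seq R,
    forall t, a < t < b -> t \notin D -> derivable (fun x => complex.Re (P x ij.1 ij.2)) t 1.
  by move=> ij; have [[_ h _] _] := cP ij.1 ij.2.
have /choice[D2 h2] : forall ij : 'I_n * 'I_n, exists D : seq R,
    forall t, a < t < b -> t \notin D -> derivable (fun x => complex.Im (P x ij.1 ij.2)) t 1.
  by move=> ij; have [_ [_ h _]] := cP ij.1 ij.2.
exists (flatten [seq D1 ij ++ D2 ij | ij <- enum {: 'I_n * 'I_n}]) => t tab tD i j.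
have : t \notin D1 (i, j) ++ D2 (i, j).
  apply: contra tD => h; apply/flattenP; exists (D1 (i, j) ++ D2 (i, j)) => //.
  by apply: map_f; rewrite mem_enum.
by rewrite mem_cat negb_or => /andP[? ?]; split; [exact: (h1 (i, j))|exact: (h2 (i, j))].
Qed.

Lemma gre_left_herm t : a < t <= b -> mlim P t^'- \is hermsymmx.
Proof.
move=> /andP[at_ tb]; apply: mcvg_herm (pw_mcvg_left pwP _); last by rewrite at_.
near=> x; have /andP[ax xt] : a < x < t by near: x; exact: left_itvoo.
by apply: hermP_in; rewrite (ltW ax) (le_trans (ltW xt) tb).
Unshelve. all: by end_near. Qed.

Lemma gre_right_herm t : a <= t < b -> mlim P t^'+ \is hermsymmx.
Proof.
move=> /andP[at_ tb]; apply: mcvg_herm (pw_mcvg_right pwP _); last by rewrite at_.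
near=> x; have /andP[tx xb] : t < x < b by near: x; exact: right_itvoo.
by apply: hermP_in; rewrite (ltW xb) (le_trans at_ (ltW tx)).
Unshelve. all: by end_near. Qed.

Let lift_herm (M : 'M[C]_n) : M \is hermsymmx ->
  (Emx R n mu mw) ^t* *m M *m Emx R n mu mw \is hermsymmx.
Proof.
by move=> hM; have := herm_congr ((Emx R n mu mw) ^t*) hM; rewrite trmxCK.
Qed.

Lemma hji_jump_herm k : (k < njumps g)%N -> hji_jump g P k \is hermsymmx.
Proof.
move=> /tj_in /andP[h1 h2]; rewrite /hji_jump.
have hR : mlim P (tj g k)^'+ \is hermsymmx.
  by apply: gre_right_herm; rewrite (ltW h1) h2.
have hL : mlim P (tj g k)^'- \is hermsymmx.
  by apply: gre_left_herm; rewrite (ltW h2) h1.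
apply: hermD; last by case: (Zjump_weight Hg k).
apply: hermD; first exact: (proj1 (jump_adjoint Hg k)).
by apply: hermN; exact: lift_herm.
Qed.

Lemma hji_herm t : a < t < b -> mderivable P t -> hji g P t \is hermsymmx.
Proof.
move=> tab dP; have tab' : a <= t <= b by case/andP: tab => /ltW -> /ltW ->.
apply: hermD; last by case: (Zflow_weight Hg tab').
apply: hermD; last by apply: (proj1 (flow_adjoint Hg t)); exact: hermP_in.
apply: lift_herm; apply: mderive_herm dP.
near=> x; have /andP[ax xb] : a < x < b by near: x; exact: near_itvoo.
by apply: hermP_in; rewrite !ltW.
Unshelve. all: by end_near. Qed.

Section along_a_trajectory.
Variables (X10 : 'M[C]_n) (X : R -> mat).
Hypothesis HX : trajectory g X10 X.
Local Notation X1 := (fun t => state (X t)).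

Let pwX : parts (pw_continuous a b) X.
Proof. by case: HX => [[]]. Qed.

Let pwX1 : parts (pw_continuous a b) X1.
Proof.
move=> i j; under eq_fun do rewrite stateE !mxE.
under [X in _ /\ pw_continuous _ _ X]eq_fun do rewrite stateE !mxE.
exact: pwX.
Qed.

Let psdX t : a <= t <= b -> psd (X t).
Proof. by case: HX => [[h _] _ _ _ _]; exact: h. Qed.

(** The terminal cost is the final pairing of [P] with the state.  Written as the
    initial pairing plus its variation along the flow and at the jumps, where
    the adjoints move the dynamics onto [P], it combines with the running costs
    into [hji] and [hji_jump]. *)
Lemma cost_expansion : exists h : R -> R,
  [/\ mes.-integrable `[a, b] (EFin \o h),
      exists D : seq R, forall t, a < t < b -> t \notin D ->
        hji g P t \is hermsymmx /\ h t = ip (hji g P t) (X t) &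
      cost g X = ip (P a) X10 + Rintegral mes `[a, b] h
        + \sum_(k < njumps g) ip (hji_jump g P k) (X (tj g k))].
Proof.
have [_ [cX1 lX1] [DX dX] rX Xa] := HX.
have [[_ Pb] [cP1 cP] _ _] := HP.
have [DP dP] := gre_mderivable.
(* The flow along [X], in the form that is piecewise continuous without knowing
   that [X] is Hermitian outside the horizon. *)
pose FX t := herm_of (apply_coords (flow g t) (X t)).
have FXE t : a <= t <= b -> FX t = flow g t (X t).
  move=> /psdX[hX _]; exact: herm_of_apply_coords (flow_linear Hg t) hX.
have pFX : parts (pw_continuous a b) FX.
  by apply: pw_herm_of => i j; exact: pw_flow.
have pdP : parts (pw_continuous a b) (mderive P).
  move=> i j; have [[_ _ h1] [_ _ h2]] := cP1 i j.
  have eR : (fun t => complex.Re (mderive P t i j)) =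
    derive1 (fun t => complex.Re (P t i j)) by apply/funext => t; rewrite mxE.
  have eI : (fun t => complex.Im (mderive P t i j)) =
    derive1 (fun t => complex.Im (P t i j)) by apply/funext => t; rewrite mxE.
  by split; [rewrite eR; exact: h1|rewrite eI; exact: h2].
pose v t := ip (mderive P t) (X1 t) + ip (P t) (FX t).
have pv : pw_continuous a b v by apply: pwD; exact: pw_ip.
pose Vl t := ip (mlim P t^'-) (mlim X1 t^'-).
pose Vr t := ip (mlim P t^'+) (mlim X1 t^'+).
pose Delta k := ip (mlim P (tj g k)^'+) (jump g k (X (tj g k)))
                - ip (mlim P (tj g k)^'-) (X1 (tj g k)).
have E : Vl b - Vr a = \int[mes]_(t in `[a, b]) v t
    + \sum_(k < njumps g | a < tj g k < b) Delta k.
  apply: (@FTC_jumps R a b (fun t => ip (P t) (X1 t)) v Vl Vr (DP ++ DX) _ _ _ ab pv).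
  - move=> t tab; rewrite mem_cat negb_or => /andP[tP tX].
    have [dX1 eX1] := dX t tab tX; rewrite /v FXE; last by case/andP: tab => /ltW -> /ltW ->.
    by rewrite -eX1; apply: is_derive_ip => //; exact: dP.
  - move=> t tab; apply: mcvg_ip; exact: pw_mcvg_right tab.
  - move=> t tab; apply: mcvg_ip; exact: pw_mcvg_left tab.
  - move=> t /andP[at_ tb].
    have ttr : a <= t < b by rewrite ltW.
    have ttl : a < t <= b by rewrite at_ ltW.
    have [[k kN tk]|nj] := pselect (jump_time g t).
      rewrite (big_pred1 (Ordinal kN)) => [|l]; last first.
        rewrite tk; apply/eqP/eqP => [/(tj_inj Hg) e|->//]; exact: val_inj.
      by rewrite /Delta /= /Vl /Vr -tk tk (mlimE _ (rX k kN)) (mlimE _ (lX1 k kN)).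
    rewrite big_pred0 => [|l]; last first.
      by apply/negbTE/eqP => e; apply: nj; exists l.
    rewrite /Vr /Vl (mlimE _ (cX1.1 t ttr nj)) (mlimE _ (cX1.2 t ttl nj)).
    by rewrite (mlimE _ (cP.1 t ttr nj)) (mlimE _ (cP.2 t ttl nj)) subrr.
have nj0 := not_jump_time0 Hg; have nj1 := not_jump_time1 Hg.
have inr : a <= a < b by rewrite lexx.
have inl : a < b <= b by rewrite lexx andbT.
have eVr : Vr a = ip (P a) X10.
  by rewrite /Vr (mlimE _ (cX1.1 a inr nj0)) (mlimE _ (cP.1 a inr nj0)) Xa.
have eVl : Vl b = ip (Zend g) (X1 b).
  by rewrite /Vl (mlimE _ (cX1.2 b inl nj1)) (mlimE _ (cP.2 b inl nj1)) Pb.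
have iZ := ip_integrable ab (Zflow_integrable Hg) pwX.
have iv := pw_integrable ab pv.
exists (fun t => ip (Zflow g t) (X t) + v t); split.
- exact: (integrable_eqE _ _ (integrableD _ iZ iv)).
- exists DP => t tab tD; have tab' : a <= t <= b by case/andP: tab => /ltW -> /ltW ->.
  split; first exact: hji_herm (dP t tab tD).
  rewrite /hji !ipDl ip_lift /v (FXE t tab') addrC; congr (_ + _ + _).
  by apply: (proj2 (flow_adjoint Hg t)); [exact: hermP_in|exact: (proj1 (psdX tab'))].
- rewrite /cost RintegralD//.
  have eD k : (k < njumps g)%N -> Delta k =
      ip (hji_jump g P k) (X (tj g k)) - ip (Zjump g k) (X (tj g k)).
    move=> /tj_in /andP[h1 h2]; rewrite /hji_jump !ipDl ipNl ip_lift addrK; congr (_ - _).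
    apply: (proj2 (jump_adjoint Hg k)).
      by apply: gre_right_herm; rewrite (ltW h1) h2.
    by apply: (proj1 (psdX _)); rewrite (ltW h1) (ltW h2).
  have sE : \sum_(k < njumps g | a < tj g k < b) Delta k =
     \sum_(k < njumps g) ip (hji_jump g P k) (X (tj g k))
     - \sum_(k < njumps g) ip (Zjump g k) (X (tj g k)).
    rewrite -sumrB; apply: eq_big => [k|k _]; last by rewrite eD.
    by rewrite (tj_window Hg) ltn_ord.
  rewrite sE eVl eVr in E.
  have balance : forall z v0 i s1 s2 iz : R,
      z - v0 = i + (s1 - s2) -> iz + s2 + z = v0 + (iz + i) + s1.
    move=> z v0 i s1 s2 iz e.
    have -> : v0 = z - (i + (s1 - s2)) by rewrite -e subKr.
    by ring.
  exact: balance E.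
Qed.

Let ae_hji_sign (Ku : R -> 'M[C]_(mu, n)) (Kw : R -> 'M[C]_(mw, n)) (D : seq R) :
  saddle_gains g P Ku Kw ->
  {ae mes, forall t, a <= t <= b -> [/\ a < t < b, t \notin D,
     riccati (hji g P t) & saddle_set (hji g P t) (Ku t) (Kw t)]}.
Proof.
move=> [_ _ hs _]; have [_ _ hr _] := HP.
have h := ae_notin (a :: b :: D).
apply: (aeS2 (aeS2 hr hs (fun t h1 h2 => conj h1 h2)) h) => t [h1 h2] tD tab.
move: tD; rewrite !inE !negb_or => /and3P[ta tb tD].
split=> //; [|exact: h1|exact: h2].
by case/andP: tab => h3 h4; rewrite !lt_neqAle (eq_sym a) ta tb h3 h4.
Qed.

Lemma cost_min_feedback Ku Kw : saddle_gains g P Ku Kw ->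
  follows_min g (gain_min Ku) X -> cost g X <= ip (P a) X10.
Proof.
move=> hs fX; have [h [ih [D hD] ->]] := cost_expansion.
have fE t : a <= t <= b ->
    X12 (X t) = Ku t *m state (X t) /\ X22 (X t) = Ku t *m state (X t) *m (Ku t)^t*.
  by move=> /fX [-> ->].
rewrite -addrA gerDl -[leRHS]addr0 lerD//.
- apply: Rintegral_le0_ae => //; apply: (aeS (ae_hji_sign D hs)) => t H.
  rewrite /= in_itv /= => tab; have [tab' tD r1 s1] := H tab.
  have [hh ->] := hD t tab' tD; have [e1 e2] := fE t tab.
  exact: ip_min_feedback hh r1 s1 (psdX tab) e1 e2.
- apply: sumr_le0 => k _; have /tj_in /andP[h1 h2] := ltn_ord k.
  have tab : a <= tj g k <= b by rewrite !ltW.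
  have [e1 e2] := fE _ tab; have [_ _ _ hr] := HP; have [_ _ _ hj] := hs.
  exact: ip_min_feedback (hji_jump_herm (ltn_ord k)) (hr _ (ltn_ord k))
    (hj _ (ltn_ord k)) (psdX tab) e1 e2.
Qed.

Lemma cost_max_feedback Ku Kw : saddle_gains g P Ku Kw ->
  follows_max g (gain_max mu Kw) X -> ip (P a) X10 <= cost g X.
Proof.
move=> hs fX; have [h [ih [D hD] ->]] := cost_expansion.
have fE t : a <= t <= b ->
    X13 (X t) = Kw t *m state (X t) /\ X33 (X t) = Kw t *m state (X t) *m (Kw t)^t*.
  by move=> /fX [[-> ->] _].
rewrite -addrA lerDl addr_ge0//.
- apply: Rintegral_ge0_ae => //; apply: (aeS (ae_hji_sign D hs)) => t H.
  rewrite /= in_itv /= => tab; have [tab' tD r1 s1] := H tab.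
  have [hh ->] := hD t tab' tD; have [e1 e2] := fE t tab.
  exact: ip_max_feedback hh r1 s1 (psdX tab) e1 e2.
- apply: sumr_ge0 => k _; have /tj_in /andP[h1 h2] := ltn_ord k.
  have tab : a <= tj g k <= b by rewrite !ltW.
  have [e1 e2] := fE _ tab; have [_ _ _ hr] := HP; have [_ _ _ hj] := hs.
  exact: ip_max_feedback (hji_jump_herm (ltn_ord k)) (hr _ (ltn_ord k))
    (hj _ (ltn_ord k)) (psdX tab) e1 e2.
Qed.

End along_a_trajectory.
End verification.

(** * Saddle point, values and uniqueness *)

Section values.
Variables (R : realType) (n mu mw : nat) (g : game R n mu mw).
Local Notation C := R[i].
Local Notation a := (t0 g).
Local Notation b := (t0 g + horizon g).
Hypothesis Hg : standing g.

Lemma feedback_play X10 (Ku : R -> 'M[C]_(mu, n)) (Kw : R -> 'M[C]_(mw, n)) :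
  psd X10 -> gains g Ku -> gains g Kw -> exists X,
  [/\ trajectory g X10 X, follows_min g (gain_min Ku) X,
      follows_max g (gain_max mu Kw) X &
      forall t, X t = lift_gains (Ku t) (Kw t) (state (X t))].
Proof.
move=> pX10 gu gw; have [X [tX eX]] := feedback_trajectory Hg gu gw pX10.
have blocks t : a <= t <= b ->
    [/\ X12 (X t) = Ku t *m state (X t), X13 (X t) = Kw t *m state (X t) &
     [/\ X22 (X t) = Ku t *m state (X t) *m (Ku t) ^t*,
         X23 (X t) = Kw t *m (X12 (X t)) ^t* &
         X33 (X t) = Kw t *m state (X t) *m (Kw t) ^t*]].
  move=> tab; have pS : psd (state (X t)).
    by apply: psd_state; case: tX => [[h _] _ _ _ _]; exact: h.
  have [_ _ e12 e13 [e22 e23 e33]] := lift_gains_blocks (Ku t) (Kw t) pS.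
  by rewrite -eX in e12 e13 e22 e23 e33; rewrite e12 e13 e22 e23 e33.
exists X; split=> // t tab; have [e12 e13 [e22 e23 e33]] := blocks t tab.
  by rewrite /gain_min e12 e22.
by rewrite /gain_max /= e13 e33 e23.
Qed.

Lemma admissible_gain_min X10 (Ku : R -> 'M[C]_(mu, n)) :
  psd X10 -> gains g Ku -> admissible_min g X10 (gain_min Ku).
Proof.
move=> pX10 gu; split=> [t X1 _ pX1|Kw gw]; first exact: psd_state_min_block.
by have [X [h1 h2 h3 _]] := feedback_play pX10 gu gw; exists X.
Qed.

Lemma admissible_gain_max X10 (Kw : R -> 'M[C]_(mw, n)) :
  psd X10 -> gains g Kw -> admissible_max g X10 (gain_max mu Kw).
Proof.
move=> pX10 gw; split=> [t X1 U _ pX1|Ku gu]; first exact: psd_assemble.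
by have [X [h1 h2 h3 _]] := feedback_play pX10 gu gw; exists X.
Qed.

Section solution.
Variables (P : R -> 'M[C]_n) (Ku : R -> 'M[C]_(mu, n)) (Kw : R -> 'M[C]_(mw, n)).
Hypotheses (HP : gre_solution g P) (HK : saddle_gains g P Ku Kw).
Variables (X10 : 'M[C]_n).
Hypothesis pX10 : psd X10.
Local Notation v := (ip (P a) X10).

Lemma saddle_gains_saddle_point : saddle_point g X10 Ku Kw v.
Proof.
have [gu gw _ _] := HK; split.
- by split; [exact: admissible_gain_min|exact: admissible_gain_max].
- have [X [tX fu fw eX]] := feedback_play pX10 gu gw; exists X; split=> //.
  apply/eqP; rewrite eq_le (cost_min_feedback Hg HP tX HK fu).
  exact: (cost_max_feedback Hg HP tX HK fw).
- by move=> X tX fX; exact: (cost_min_feedback Hg HP tX HK fX).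
- by move=> X tX fX; exact: (cost_max_feedback Hg HP tX HK fX).
Qed.

(** Any admissible law of the minimizer has a closed loop with the saddle gain of
    the maximizer, which secures the value. *)
Lemma gre_minimax_value : minimax_value g X10 v.
Proof.
have [gu gw _ _] := HK; have [[au _] [X0 [tX0 eX0 cX0]] ub _] := saddle_gains_saddle_point.
split.
  exists (gain_min Ku) => //; split.
    have [X [tX fu fw eX]] := feedback_play pX10 gu gw.
    exists X; first by split.
    apply/eqP; rewrite eq_le (cost_min_feedback Hg HP tX HK fu).
    exact: (cost_max_feedback Hg HP tX HK fw).
  by move=> _ [X [tX fX] <-]; exact: ub.
move=> f [_ /(_ _ gw)[X [tX fX fw]]].
apply: (@le_trans _ _ (cost g X)%:E).
  by rewrite lee_fin; exact: (cost_max_feedback Hg HP tX HK fw).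
by apply: ereal_sup_ubound; exists (cost g X) => //; exists X.
Qed.

Lemma gre_maximin_value : maximin_value g X10 v.
Proof.
have [gu gw _ _] := HK; have [[_ aw] _ _ lb] := saddle_gains_saddle_point.
split.
  exists (gain_max mu Kw) => //; split.
    have [X [tX fu fw eX]] := feedback_play pX10 gu gw.
    exists X; first by split.
    apply/eqP; rewrite eq_le (cost_min_feedback Hg HP tX HK fu).
    exact: (cost_max_feedback Hg HP tX HK fw).
  by move=> _ [X [tX fX] <-]; exact: lb.
move=> h [_ /(_ _ gu)[X [tX fX fu]]].
apply: (@le_trans _ _ (cost g X)%:E); last first.
  by rewrite lee_fin; exact: (cost_min_feedback Hg HP tX HK fu).
by apply: ereal_inf_lbound; exists (cost g X) => //; exists X.
Qed.

End solution.

Lemma minimax_value_le X10 v v' :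
  minimax_value g X10 v -> minimax_value g X10 v' -> v' <= v.
Proof.
move=> [[f af [_ ubf]] _] [_ /(_ f af)]; rewrite -lee_fin => /le_trans; apply.
by apply: ge_ereal_sup => _ [c cf <-]; rewrite lee_fin; exact: ubf.
Qed.

Lemma minimax_value_unique X10 v v' :
  minimax_value g X10 v -> minimax_value g X10 v' -> v = v'.
Proof.
by move=> h h'; apply/eqP; rewrite eq_le (minimax_value_le h' h) (minimax_value_le h h').
Qed.

End values.

Section restriction.
Variables (R : realType) (n mu mw : nat) (g : game R n mu mw).
Local Notation C := R[i].
Local Notation a := (t0 g).
Local Notation b := (t0 g + horizon g).

(** The first [j] jumps are those before [s]; dropping them keeps the convention
    that the jumps of a game are numbered from 0. *)
Definition from_time (s : R) (j : nat) : game R n mu mw :=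
  Game s (b - s) (fun k => tj g (k + j)) (njumps g - j) (flow g) (flow_adj g)
    (fun k => jump g (k + j)) (fun k => jump_adj g (k + j))
    (Zflow g) (fun k => Zjump g (k + j)) (Zend g).

Variables (s : R) (j : nat).
Hypothesis Hg : standing g.
Hypothesis asb : a <= s < b.
Hypothesis sJ : ~ jump_time g s.
Hypothesis jP : forall i, (tj g i < s) = (i < j)%N.

Let as_ : a <= s. Proof. by case/andP: asb. Qed.
Let sb : s < b. Proof. by case/andP: asb. Qed.
Let eb : s + (b - s) = b. Proof. by rewrite addrC subrK. Qed.

Lemma from_time_jump t : s <= t -> jump_time g t -> jump_time (from_time s j) t.
Proof.
move=> st [k kN e]; have jk : (j <= k)%N.
  by rewrite leqNgt -jP -leNgt -e.
exists (k - j)%N; first by rewrite /= ltn_sub2rE.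
by rewrite /= subnK.
Qed.

Lemma from_time_standing : standing (from_time s j).
Proof.
split=> /=.
- by rewrite subr_gt0.
- by move=> k l kl; apply: (tj_increasing Hg); rewrite ltn_add2r.
- by have := tj_unbounded Hg; rewrite -(cvg_shiftn j).
- move=> k; rewrite eb ltn_subRL (addnC j k).
  have [kN|nkN] := boolP (k + j < njumps g)%N.
    have /andP[h1 h2] : a < tj g (k + j) < b by rewrite (tj_window Hg).
    rewrite h2 andbT lt_neqAle leNgt jP -leqNgt leq_addl andbT.
    by apply/negP => /eqP e; apply: sJ; exists (k + j)%N.
  apply/negP => /andP[h1 h2]; move/negP: nkN; apply.
  by rewrite -(tj_window Hg) h2 andbT (le_lt_trans as_ h1).
- exact: flow_linear Hg.
- move=> X hX i k; rewrite eb; have [h1 h2] := flow_continuous Hg hX i k.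
  have sub : `[s, b] `<=` `[a, b] by apply: subset_itvr; rewrite bnd_simp.
  by split; [exact: continuous_subspaceW sub h1|exact: continuous_subspaceW sub h2].
- exact: flow_adjoint Hg.
- move=> s' e K S Y /= ss' s'e; rewrite eb => eb'.
  exact: (flow_cone Hg (le_trans as_ ss') s'e eb').
- by move=> k; exact: (jump_linear Hg).
- by move=> k; exact: (jump_adjoint Hg).
- by move=> k; exact: (jump_cone Hg).
- move=> t; rewrite eb => /andP[st tb]; apply: (Zflow_weight Hg).
  by rewrite (le_trans as_ st).
- move=> i k; rewrite eb; have [h1 h2] := Zflow_integrable Hg i k.
  have sub : `[s, b] `<=` `[a, b] by apply: subset_itvr; rewrite bnd_simp.
  by split; [apply: integrableS h1|apply: integrableS h2].
- by move=> k; exact: (Zjump_weight Hg).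
- exact: (Zend_psd Hg).
Qed.

Lemma from_time_gre P : gre_solution g P -> gre_solution (from_time s j) P.
Proof.
move=> [[pP Pb] [cP [rP lP]] fl ju]; split=> /=; rewrite ?eb.
- split=> // t /andP[st tb]; apply: pP; rewrite tb (le_trans as_ st)//.
- split.
    move=> i k; have [[h1 [D1 d1] h2] [h3 [D2 d2] h4]] := cP i k.
    split; split.
    + exact: pw_sub as_ (lexx b) h1.
    + by exists D1 => t /andP[st tb]; apply: d1; rewrite tb (le_lt_trans as_ st).
    + exact: pw_sub as_ (lexx b) h2.
    + exact: pw_sub as_ (lexx b) h3.
    + by exists D2 => t /andP[st tb]; apply: d2; rewrite tb (le_lt_trans as_ st).
    + exact: pw_sub as_ (lexx b) h4.
  split=> t /andP[st tb] nj.
    apply: rP; first by rewrite tb (le_trans as_ st).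
    by move=> /(from_time_jump st).
  apply: lP; first by rewrite tb (le_lt_trans as_ st).
  by move=> /(from_time_jump (ltW st)).
- by apply: (aeS fl) => t h /andP[st tb]; apply: h; rewrite tb (le_trans as_ st).
- by move=> k kN; apply: ju; rewrite addnC -ltn_subRL.
Qed.

Lemma from_time_saddle_gains P Ku Kw :
  saddle_gains g P Ku Kw -> saddle_gains (from_time s j) P Ku Kw.
Proof.
move=> [gu gw fl ju]; split=> /=; rewrite ?eb.
- by rewrite /gains /= eb; exact: pw_partsS as_ (lexx b) gu.
- by rewrite /gains /= eb; exact: pw_partsS as_ (lexx b) gw.
- by apply: (aeS fl) => t h /andP[st tb]; apply: h; rewrite tb (le_trans as_ st).
- by move=> k kN; apply: ju; rewrite addnC -ltn_subRL.
Qed.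

End restriction.

Section uniqueness.
Variables (R : realType) (n mu mw : nat) (g : game R n mu mw).
Local Notation C := R[i].
Local Notation a := (t0 g).
Local Notation b := (t0 g + horizon g).
Hypothesis Hg : standing g.

Lemma past_jumps (s : R) : exists j, forall i, (tj g i < s) = (i < j)%N.
Proof.
have ex : exists i, s <= tj g i.
  have /cvgryPge/(_ s)[N _ hN] := tj_unbounded Hg.
  by exists N; exact: hN (leqnn N).
case: (ex_minnP ex) => j sj jmin; exists j => i.
apply/idP/idP => [tis|ij].
  rewrite ltnNge; apply/negP => ji; have : tj g j <= tj g i.
    by move: ji; rewrite leq_eqVlt => /predU1P[->//|/(tj_increasing Hg)/ltW].
  by rewrite leNgt (lt_le_trans tis sj).
by rewrite ltNge; apply/negP => /jmin; rewrite leqNgt ij.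
Qed.

Variables (P P' : R -> 'M[C]_n).
Hypotheses (HP : gre_solution g P) (HP' : gre_solution g P').
Hypotheses (HK : exists Ku Kw, saddle_gains g P Ku Kw)
  (HK' : exists Ku Kw, saddle_gains g P' Ku Kw).

(** Both solutions give the value of the game started at [s], from every
    initial state, and these values determine a Hermitian matrix. *)
Lemma gre_unique_off_jumps s : a <= s <= b -> ~ jump_time g s -> P' s = P s.
Proof.
move=> /andP[as_]; rewrite le_eqVlt => /predU1P[-> _|sb sJ].
  by case: HP => [[_ ->] _ _ _]; case: HP' => [[_ ->] _ _ _].
have asb : a <= s < b by rewrite as_.
have asb' : a <= s <= b by rewrite as_ ltW.
have [j jP] := past_jumps s.
have Sg := from_time_standing Hg asb sJ jP.
have [Ku [Kw K1]] := HK; have [Ku' [Kw' K1']] := HK'.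
apply: herm_ip_psd_inj.
- by case: HP' => [[h _] _ _ _]; exact: (proj1 (h s asb')).
- by case: HP => [[h _] _ _ _]; exact: (proj1 (h s asb')).
move=> X pX; apply: (@minimax_value_unique _ _ _ _ (from_time g s j) X).
  exact: (gre_minimax_value Sg (from_time_gre asb jP HP')
            (from_time_saddle_gains j asb K1') pX).
exact: (gre_minimax_value Sg (from_time_gre asb jP HP)
          (from_time_saddle_gains j asb K1) pX).
Qed.

Lemma mlim_near_eq p q (F : set_system R) (FF : ProperFilter F)
    (A B : R -> 'M[C]_(p, q)) L :
  (\forall x \near F, A x = B x) -> mcvg B F L -> mlim A F = mlim B F.
Proof.
move=> AB BL; rewrite (mlimE _ BL); apply: mlimE; apply: mcvg_near_eq BL.
by apply: filterS AB => x ->.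
Qed.

Lemma near_not_jump_time t : a < t < b ->
  (\forall x \near t^'-, a <= x <= b /\ ~ jump_time g x) /\
  (\forall x \near t^'+, a <= x <= b /\ ~ jump_time g x).
Proof.
move=> tab; have avoid (J : seq R) : \forall x \near t, x != t -> x \notin J.
  elim: J => [|u J IH]; first by near=> x.
  have [->|ut] := eqVneq u t.
    by apply: filterS IH => x h xt; rewrite inE negb_or xt h.
  have hu : \forall x \near t, x != u.
    have [tu|tu|e] := ltgtP t u; last by rewrite e eqxx in ut.
      by near=> x; rewrite lt_eqF//; near: x; exact: lt_nbhsl.
    by near=> x; rewrite gt_eqF//; near: x; exact: lt_nbhsr.
  by apply: filterS2 hu IH => x xu h xt; rewrite inE negb_or xu h.
pose J := [seq tj g k | k <- iota 0 (njumps g)].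
have good x : a < x < b -> x \notin J -> a <= x <= b /\ ~ jump_time g x.
  move=> /andP[ax xb] xJ; rewrite !ltW//; split=> // -[k kN e].
  by move/negP: xJ; apply; rewrite e; apply: map_f; rewrite mem_iota /= add0n.
have N : \forall x \near t, x != t -> a <= x <= b /\ ~ jump_time g x.
  by apply: filterS2 (near_itvoo tab) (avoid J) => x h1 h2 xt; apply: good => //; exact: h2.
split; near=> x.
  have xt : x < t by near: x; exact: nbhs_left_lt.
  suff : x != t -> a <= x <= b /\ ~ jump_time g x by apply; rewrite lt_eqF.
  by near: x; apply: cvg_at_left_filter N; exact: cvg_id.
have xt : t < x by near: x; exact: nbhs_right_gt.
suff : x != t -> a <= x <= b /\ ~ jump_time g x by apply; rewrite gt_eqF.
by near: x; apply: cvg_at_right_filter N; exact: cvg_id.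
Unshelve. all: by end_near. Qed.

Lemma gre_unique_at_jumps k : (k < njumps g)%N ->
  mlim P' (tj g k)^'- = mlim P (tj g k)^'- /\
  mlim P' (tj g k)^'+ = mlim P (tj g k)^'+.
Proof.
rewrite -(tj_window Hg) => tab; have [nl nr] := near_not_jump_time tab.
have pwP : parts (pw_continuous a b) P.
  by case: HP => _ [cP _] _ _ i j; have [[? _ _] [? _ _]] := cP i j.
have tl : a < tj g k <= b by case/andP: tab => -> /ltW ->.
have tr : a <= tj g k < b by case/andP: tab => /ltW -> ->.
split.
  apply: (mlim_near_eq _ _ (pw_mcvg_left pwP tl)).
  by apply: filterS nl => x [h1 h2]; exact: gre_unique_off_jumps.
apply: (mlim_near_eq _ _ (pw_mcvg_right pwP tr)).
by apply: filterS nr => x [h1 h2]; exact: gre_unique_off_jumps.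
Qed.

End uniqueness.

Theorem theorem6p7 (R : realType) (n mu mw : nat)
    (n_gt0 : (0 < n)%N) (mu_gt0 : (0 < mu)%N) (mw_gt0 : (0 < mw)%N)
    (g : game R n mu mw) (Hg : standing g)
    (P : R -> 'M[R[i]]_n) (HP : gre_solution g P)
    (HI : isaacs_everywhere g P)
    (HK : exists Ku Kw, saddle_gains g P Ku Kw) :
  (forall X10 : 'M[R[i]]_n, psd X10 ->
     let v := ip (P (t0 g)) X10 in
     [/\ (* (a) *) minimax_value g X10 v,
         (* (b) *) (exists Ku Kw,
                      saddle_gains g P Ku Kw /\ saddle_point g X10 Ku Kw v) /\
                   (forall Ku Kw,
                      saddle_gains g P Ku Kw -> saddle_point g X10 Ku Kw v)
       & (* (c) *) minimax_value g X10 v /\ maximin_value g X10 v]) /\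
  (* (d) *)
  (forall P' : R -> 'M[R[i]]_n, gre_solution g P' ->
     (exists Ku Kw, saddle_gains g P' Ku Kw) ->
     (forall t, t0 g <= t <= t0 g + horizon g -> ~ jump_time g t ->
        P' t = P t) /\
     (forall k, (k < njumps g)%N ->
        mlim P' (tj g k)^'- = mlim P (tj g k)^'- /\
        mlim P' (tj g k)^'+ = mlim P (tj g k)^'+)).
Proof.
have [Ku [Kw K1]] := HK; split.
  move=> X10 pX10 v; split.
  - exact: (gre_minimax_value Hg HP K1 pX10).
  - split; last by move=> Ku' Kw' K2; exact: (saddle_gains_saddle_point Hg HP K2 pX10).
    by exists Ku, Kw; split; [exact: K1|exact: (saddle_gains_saddle_point Hg HP K1 pX10)].
  - split; first exact: (gre_minimax_value Hg HP K1 pX10).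
    exact: (gre_maximin_value Hg HP K1 pX10).
move=> P' HP' HK'; split=> [t tab nj|k kN].
  exact: (gre_unique_off_jumps Hg HP HP' HK HK' tab nj).
exact: (gre_unique_at_jumps Hg HP HP' HK HK' kN).
Qed.
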